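(* Let $K:\mathbb{Z}^2\to[0,\infty)$ satisfy $\sup_{k,l\in\mathbb{Z}}K(k,l)\le C_K$ for some $C_K\in(0,\infty)$, and let $Q$ be the associated collision operator. Let $X\in\{\ell_1(\mathbb{Z}),\ell_{1,1}(\mathbb{Z})\}$ and $f_0\in X$. Then the following assertions hold for the initial value problem $\dot f(t)=Q(f(t))$, $t>0$, $f(0)=f_0$. (i) There exists a unique maximal ($X$-)solution $f=\varphi(\,\cdot\,;f_0)\in C^1([0,t^+(f_0));X)$. (ii) If $t^+(f_0)<\infty$, then $\lim_{t\to t^+(f_0)}\|f(t)\|_X=\infty$. (iii) For every $T\in(0,t^+(f_0))$ there exists $\delta=\delta(f_0,T)>0$ such that $t^+(g_0)>T$ for all $g_0\in\bar B_X(f_0,\delta)$. Moreover, the map $\bar B_X(f_0,\delta)\to C^1([0,T];X)$, $g_0\mapsto\varphi(\,\cdot\,;g_0)$, is Lipschitz continuous.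
   Context: $\ell_1(\mathbb{Z})$ is the Banach space of real functions $g:\mathbb{Z}\to\mathbb{R}$ with $\|g\|_1=\sum_{k\in\mathbb{Z}}|g(k)|<\infty$; $\ell_{1,1}(\mathbb{Z})=\{g\in\ell_1(\mathbb{Z}):\|g\|_{1,1}:=\sum_{k\in\mathbb{Z}}(1+|k|)|g(k)|<\infty\}$. The collision operator associated with the kernel $K$ is $Q(f)=Q(f,f)$, where for $k\in\mathbb{Z}$ $$Q(f,g)(k)=\sum_{l\in\mathbb{Z}}\Big(K(l,k-1)g(l)f(k-1)-K(k,l-1)f(k)g(l-1)-K(l,k)g(l)f(k)+K(k+1,l-1)f(k+1)g(l-1)\Big).$$ For bounded $K$, $Q$ maps $X$ into $X$ for $X\in\{\ell_1(\mathbb{Z}),\ell_{1,1}(\mathbb{Z})\}$. An $X$-solution on $[0,\tau)$ is a function $f\in C^1([0,\tau);X)$ satisfying the initial value problem; $t^+(f_0)\in(0,\infty]$ denotes the maximal existence time, and $\varphi(\,\cdot\,;f_0)$ the maximal solution with initial value $f_0$. $\bar B_X(f_0,\delta)$ is the closed ball in $X$ with centre $f_0$ and radius $\delta$. *)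

(* Defs.v *)
From Stdlib Require Import Reals ZArith Lra Lia.
From Stdlib Require Import FunctionalExtensionality ProofIrrelevance ClassicalEpsilon.
From Coquelicot Require Import Coquelicot.

Open Scope R_scope.

(* For absolutely summable families, the only ones to which it is applied, the
   order of summation is irrelevant. *)
Definition sumZ (u : Z -> R) : R :=
  Series (fun n => u (Z.of_nat n)) + Series (fun n => u (- Z.of_nat (S n))%Z).

Definition ex_sumZ (u : Z -> R) : Prop :=
  ex_series (fun n => u (Z.of_nat n)) /\
  ex_series (fun n => u (- Z.of_nat (S n))%Z).

Lemma ex_sumZ_le u v :
  (forall k, 0 <= u k <= v k) -> ex_sumZ v -> ex_sumZ u.
Proof.
  intros H [Hp Hn]; split.
  - apply (@ex_series_le R_AbsRing R_CompleteNormedModule) with (2 := Hp).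
    intros n; unfold norm; simpl; unfold abs; simpl.
    rewrite Rabs_pos_eq; apply H.
  - apply (@ex_series_le R_AbsRing R_CompleteNormedModule) with (2 := Hn).
    intros n; unfold norm; simpl; unfold abs; simpl.
    rewrite Rabs_pos_eq; apply H.
Qed.

Lemma ex_sumZ_plus u v :
  ex_sumZ u -> ex_sumZ v -> ex_sumZ (fun k => u k + v k).
Proof.
  intros [Hp Hn] [Gp Gn]; split.
  - exact (ex_series_plus _ _ Hp Gp).
  - exact (ex_series_plus _ _ Hn Gn).
Qed.

Lemma ex_sumZ_scal c u : ex_sumZ u -> ex_sumZ (fun k => c * u k).
Proof.
  intros [Hp Hn]; split.
  - exact (ex_series_scal c _ Hp).
  - exact (ex_series_scal c _ Hn).
Qed.

Lemma ex_sumZ_0 : ex_sumZ (fun _ => 0).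
Proof.
  assert (H : ex_series (fun _ : nat => 0)).
  { exists 0. apply filterlim_ext with (fun _ : nat => 0).
    - intros n; rewrite sum_n_const; ring.
    - apply filterlim_const. }
  split; exact H.
Qed.

Lemma sumZ_le u v :
  (forall k, 0 <= u k <= v k) -> ex_sumZ v -> sumZ u <= sumZ v.
Proof.
  intros H [Hp Hn]; apply Rplus_le_compat; apply Series_le; auto.
Qed.

Lemma sumZ_plus u v :
  ex_sumZ u -> ex_sumZ v -> sumZ (fun k => u k + v k) = sumZ u + sumZ v.
Proof.
  intros [Hp Hn] [Gp Gn]; unfold sumZ.
  rewrite !Series_plus by assumption; ring.
Qed.

Lemma sumZ_scal c u : sumZ (fun k => c * u k) = c * sumZ u.
Proof.
  unfold sumZ; rewrite !Series_scal_l; ring.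
Qed.

Lemma sumZ_ext u v : (forall k, u k = v k) -> sumZ u = sumZ v.
Proof.
  intros H; unfold sumZ; f_equal; apply Series_ext; intros n; apply H.
Qed.

Lemma Series_ge_term (a : nat -> R) n :
  (forall m, 0 <= a m) -> ex_series a -> a n <= Series a.
Proof.
  intros Ha Hex.
  rewrite (Series_incr_n a (S n)) by (auto; lia); simpl pred.
  assert (Hs : a n <= sum_f_R0 a n).
  { destruct n as [|n]; simpl; [lra|].
    assert (0 <= sum_f_R0 a n) by (apply cond_pos_sum; exact Ha); lra. }
  assert (Ht : 0 <= Series (fun k => a (S n + k)%nat)).
  { replace 0 with (Series (fun _ : nat => 0 * 0))
      by (rewrite Series_scal_l; ring).
    apply Series_le.
    - intros m; rewrite Rmult_0_l; split; [lra | apply Ha].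
    - apply ex_series_incr_n; exact Hex. }
  lra.
Qed.

Lemma sumZ_ge_term u k : (forall k, 0 <= u k) -> ex_sumZ u -> u k <= sumZ u.
Proof.
  intros Hu [Hp Hn]; unfold sumZ.
  assert (Ap := Series_ge_term _ (Z.to_nat k) (fun m => Hu (Z.of_nat m)) Hp).
  assert (An := Series_ge_term _ (Nat.pred (Z.to_nat (- k)))
                  (fun m => Hu (- Z.of_nat (S m))%Z) Hn).
  assert (Bp := Series_ge_term _ O (fun m => Hu (Z.of_nat m)) Hp).
  assert (Bn := Series_ge_term _ O (fun m => Hu (- Z.of_nat (S m))%Z) Hn).
  cbv beta in *.
  assert (H0 := Hu (Z.of_nat O)); assert (H1 := Hu (- Z.of_nat 1)%Z).
  destruct (Z_le_gt_dec 0 k) as [Hk|Hk].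
  - rewrite Z2Nat.id in Ap by lia; lra.
  - replace (- Z.of_nat (S (Nat.pred (Z.to_nat (- k)))))%Z with k in An by lia.
    lra.
Qed.

Inductive lspace := l1 | l11.

Definition weight (X : lspace) (k : Z) : R :=
  match X with
  | l1 => 1
  | l11 => 1 + Rabs (IZR k)
  end.

Lemma weight_ge_1 X k : 1 <= weight X k.
Proof.
  destruct X; simpl; [lra|]; assert (H := Rabs_pos (IZR k)); lra.
Qed.

(* As the weights are at least 1, membership in [l_{1,1}(Z)] implies membership
   in [l_1(Z)], which therefore needs no separate clause. *)
Record elt (X : lspace) := Elt {
  coef :> Z -> R;
  coef_summable : ex_sumZ (fun k => weight X k * Rabs (coef k)) }.

Arguments Elt {X} _ _.
Arguments coef {X} _ _.
Arguments coef_summable {X} _.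

Section Structures.

Context (X : lspace).

Lemma elt_eq (f g : elt X) : (forall k, f k = g k) -> f = g.
Proof.
  destruct f as [f Hf], g as [g Hg]; simpl; intros E.
  assert (E' : f = g) by (apply functional_extensionality; exact E).
  subst g; f_equal; apply proof_irrelevance.
Qed.

Lemma wabs_ge0 (u : Z -> R) k : 0 <= weight X k * Rabs (u k).
Proof.
  apply Rmult_le_pos; [|apply Rabs_pos].
  assert (H := weight_ge_1 X k); lra.
Qed.

Lemma wabs_plus (u v : Z -> R) k :
  0 <= weight X k * Rabs (u k + v k)
    <= weight X k * Rabs (u k) + weight X k * Rabs (v k).
Proof.
  split; [exact (wabs_ge0 (fun k => u k + v k) k)|].
  rewrite <- Rmult_plus_distr_l; apply Rmult_le_compat_l; [|apply Rabs_triang].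
  assert (H := weight_ge_1 X k); lra.
Qed.

Lemma wabs_scal c (u : Z -> R) k :
  weight X k * Rabs (c * u k) = Rabs c * (weight X k * Rabs (u k)).
Proof. rewrite Rabs_mult; ring. Qed.

Lemma elt_plus_summable (f g : elt X) :
  ex_sumZ (fun k => weight X k * Rabs (f k + g k)).
Proof.
  eapply ex_sumZ_le; [apply wabs_plus|].
  apply ex_sumZ_plus; apply coef_summable.
Qed.

Lemma elt_scal_summable c (f : elt X) :
  ex_sumZ (fun k => weight X k * Rabs (c * f k)).
Proof.
  apply ex_sumZ_le with (fun k => Rabs c * (weight X k * Rabs (f k))).
  - intros k; rewrite <- wabs_scal; split; [|apply Rle_refl].
    exact (wabs_ge0 (fun k => c * f k) k).
  - apply ex_sumZ_scal, coef_summable.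
Qed.

Lemma elt_opp_summable (f : elt X) :
  ex_sumZ (fun k => weight X k * Rabs (- f k)).
Proof.
  apply ex_sumZ_le with (2 := coef_summable f).
  intros k; rewrite Rabs_Ropp; split; [apply wabs_ge0 | apply Rle_refl].
Qed.

Lemma elt_zero_summable : ex_sumZ (fun k => weight X k * Rabs 0).
Proof.
  apply ex_sumZ_le with (2 := ex_sumZ_0).
  intros k; rewrite Rabs_R0, Rmult_0_r; lra.
Qed.

Definition elt_plus (f g : elt X) : elt X := Elt _ (elt_plus_summable f g).
Definition elt_opp (f : elt X) : elt X := Elt _ (elt_opp_summable f).
Definition elt_zero : elt X := Elt _ elt_zero_summable.
Definition elt_scal (c : R) (f : elt X) : elt X := Elt _ (elt_scal_summable c f).
Definition elt_norm (f : elt X) : R := sumZ (fun k => weight X k * Rabs (f k)).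

Definition elt_AbelianMonoid_mixin : AbelianMonoid.mixin_of (elt X).
Proof.
  refine (AbelianMonoid.Mixin (elt X) elt_plus elt_zero _ _ _);
    intros; apply elt_eq; intros k; simpl; ring.
Defined.

Canonical elt_AbelianMonoid :=
  AbelianMonoid.Pack (elt X) elt_AbelianMonoid_mixin (elt X).

Definition elt_AbelianGroup_mixin : AbelianGroup.mixin_of elt_AbelianMonoid.
Proof.
  refine (AbelianGroup.Mixin elt_AbelianMonoid elt_opp _).
  intros f; apply elt_eq; intros k; simpl; ring.
Defined.

Canonical elt_AbelianGroup :=
  AbelianGroup.Pack (elt X)
    (AbelianGroup.Class (elt X) _ elt_AbelianGroup_mixin) (elt X).

Definition elt_ModuleSpace_mixin : ModuleSpace.mixin_of R_Ring elt_AbelianGroup.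
Proof.
  refine (ModuleSpace.Mixin R_Ring elt_AbelianGroup elt_scal _ _ _ _);
    intros; apply elt_eq; intros k; unfold mult, plus, one; simpl; ring.
Defined.

Canonical elt_ModuleSpace :=
  ModuleSpace.Pack R_Ring (elt X)
    (ModuleSpace.Class R_Ring (elt X) _ elt_ModuleSpace_mixin) (elt X).

Lemma elt_norm_triangle f g : elt_norm (elt_plus f g) <= elt_norm f + elt_norm g.
Proof.
  unfold elt_norm; rewrite <- sumZ_plus by apply coef_summable.
  apply sumZ_le; [intros k; apply wabs_plus|].
  apply ex_sumZ_plus; apply coef_summable.
Qed.

Lemma elt_norm_scal c f : elt_norm (elt_scal c f) = Rabs c * elt_norm f.
Proof.
  unfold elt_norm; rewrite <- sumZ_scal.
  apply sumZ_ext; intros k; apply wabs_scal.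
Qed.

Lemma elt_norm_eq0 f : elt_norm f = 0 -> f = elt_zero.
Proof.
  intros H; apply elt_eq; intros k; simpl.
  assert (Hk := sumZ_ge_term _ k (wabs_ge0 f) (coef_summable f)).
  cbv beta in Hk; fold (elt_norm f) in Hk; rewrite H in Hk.
  assert (Hw := weight_ge_1 X k).
  assert (Ha := Rabs_pos (f k)).
  assert (Rabs (f k) = 0) by nra.
  destruct (Req_dec (f k) 0) as [E|E]; [exact E|].
  exfalso; exact (Rabs_no_R0 _ E H0).
Qed.

Definition elt_ball (f : elt X) (eps : R) (g : elt X) : Prop :=
  elt_norm (minus g f) < eps.

Lemma elt_ball_center f (eps : posreal) : elt_ball f eps f.
Proof.
  unfold elt_ball.
  replace (minus f f) with (elt_scal 0 f)
    by (apply elt_eq; intros k; simpl; ring).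
  rewrite elt_norm_scal, Rabs_R0, Rmult_0_l; apply cond_pos.
Qed.

Lemma elt_ball_sym f g eps : elt_ball f eps g -> elt_ball g eps f.
Proof.
  unfold elt_ball; intros H.
  replace (minus f g) with (elt_scal (Ropp 1) (minus g f))
    by (apply elt_eq; intros k; simpl; ring).
  rewrite elt_norm_scal, Rabs_Ropp, Rabs_R1, Rmult_1_l; exact H.
Qed.

Lemma elt_ball_triangle f g h d e :
  elt_ball f d g -> elt_ball g e h -> elt_ball f (d + e) h.
Proof.
  unfold elt_ball; intros Hd He.
  replace (minus h f) with (elt_plus (minus h g) (minus g f))
    by (apply elt_eq; intros k; simpl; ring).
  assert (H := elt_norm_triangle (minus h g) (minus g f)); lra.
Qed.

Definition elt_UniformSpace_mixin : UniformSpace.mixin_of (elt X) :=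
  UniformSpace.Mixin (elt X) elt_zero elt_ball
    elt_ball_center elt_ball_sym elt_ball_triangle.

Canonical elt_UniformSpace :=
  UniformSpace.Pack (elt X) elt_UniformSpace_mixin (elt X).

Canonical elt_NormedModuleAux :=
  NormedModuleAux.Pack R_AbsRing (elt X)
    (NormedModuleAux.Class R_AbsRing (elt X)
       (ModuleSpace.class R_Ring elt_ModuleSpace) elt_UniformSpace_mixin)
    (elt X).

Definition elt_NormedModule_mixin :
  NormedModule.mixin_of R_AbsRing elt_NormedModuleAux.
Proof.
  refine (NormedModule.Mixin R_AbsRing elt_NormedModuleAux elt_norm 1
            elt_norm_triangle _ _ _ elt_norm_eq0).
  - intros c f; apply Req_le, elt_norm_scal.
  - intros f g eps H; exact H.
  - intros f g eps H; rewrite Rmult_1_l; exact H.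
Defined.

Canonical elt_NormedModule :=
  NormedModule.Pack R_AbsRing (elt X)
    (NormedModule.Class R_AbsRing (elt X) _ elt_NormedModule_mixin) (elt X).

End Structures.

Definition collision (K : Z -> Z -> R) (f g : Z -> R) (k : Z) : R :=
  sumZ (fun l =>
      K l (k - 1)%Z * g l * f (k - 1)%Z
    - K k (l - 1)%Z * f k * g (l - 1)%Z
    - K l k * g l * f k
    + K (k + 1)%Z (l - 1)%Z * f (k + 1)%Z * g (l - 1)%Z).

Definition Q (K : Z -> Z -> R) (f : Z -> R) : Z -> R := collision K f f.

Section C1.

Context {V : NormedModule R_AbsRing}.

(* Derivative relative to [D]; one-sided at an end point of an interval [D]. *)
Definition is_derive_on (D : R -> Prop) (f : R -> V) (t : R) (l : V) : Prop :=
  filterdiff f (within D (locally t)) (fun h => scal h l).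

(* Meaningful only when the derivative exists. *)
Definition Derive_on (D : R -> Prop) (f : R -> V) (t : R) : V :=
  epsilon (inhabits zero) (is_derive_on D f t).

Definition C1_on (D : R -> Prop) (f : R -> V) : Prop :=
  (forall t, D t -> is_derive_on D f t (Derive_on D f t)) /\
  continuous_on D (Derive_on D f).

Definition sup_norm (D : R -> Prop) (f : R -> V) : Rbar :=
  Lub_Rbar (fun r => exists t, D t /\ r = norm (f t)).

Definition C1_norm (D : R -> Prop) (f : R -> V) : Rbar :=
  Rbar_plus (sup_norm D f) (sup_norm D (Derive_on D f)).

End C1.

Definition Ico0 (tau : Rbar) (t : R) : Prop := 0 <= t /\ Rbar_lt t tau.
Definition Icc0 (T : R) (t : R) : Prop := 0 <= t <= T.

(* A function on [0, tau) is represented by a function on [R] whose values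
   outside [0, tau) are irrelevant.  The equation is an equality of real
   sequences: the left-hand side is an element of [X], so it entails that
   [Q(f(t))] belongs to [X]. *)
Definition is_solution (K : Z -> Z -> R) {X : lspace} (f0 : elt X)
    (tau : Rbar) (f : R -> elt X) : Prop :=
  Rbar_lt 0 tau /\
  C1_on (Ico0 tau) f /\
  f 0 = f0 /\
  forall t, 0 < t -> Rbar_lt t tau ->
    forall k, Derive_on (Ico0 tau) f t k = Q K (f t) k.

Definition is_maximal_solution (K : Z -> Z -> R) {X : lspace} (f0 : elt X)
    (tau : Rbar) (f : R -> elt X) : Prop :=
  is_solution K f0 tau f /\
  forall (sigma : Rbar) (g : R -> elt X),
    is_solution K f0 sigma g -> (forall t, Ico0 tau t -> g t = f t) ->
    Rbar_le sigma tau.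

(* A maximal solution with its existence time; meaningful only when there is
   one, and determined (on its interval) only when it is unique. *)
Definition maximal_solution (K : Z -> Z -> R) {X : lspace} (f0 : elt X) :
    Rbar * (R -> elt X) :=
  epsilon (inhabits (p_infty, fun _ => f0))
    (fun p => is_maximal_solution K f0 (fst p) (snd p)).

Definition tplus K {X : lspace} (f0 : elt X) : Rbar := fst (maximal_solution K f0).

Definition phi K {X : lspace} (f0 : elt X) : R -> elt X :=
  snd (maximal_solution K f0).

(* Main.v *)
Require Import Defs.
From Stdlib Require Import Reals ZArith.
From Coquelicot Require Import Coquelicot.
From Stdlib Require Import Lra Lia List.
From Stdlib Require Import FunctionalExtensionality PropExtensionality ClassicalEpsilon.
Open Scope R_scope.

(** Since the weights satisfy [w k <= 2 w (k +- 1)] and [K] is bounded, [Q] is a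
    bounded quadratic map of [X], hence Lipschitz on balls.  Precomposing it with
    the radial retraction onto a ball makes it globally Lipschitz without changing
    it on the ball; the truncated equation has global solutions by Picard
    iteration in the norm weighted by [exp (- 2 L t)], and these depend on their
    initial values in a Lipschitz way by Gronwall.  A solution on a compact
    interval is bounded, so it coincides with a solution of a truncated equation.
    The maximal existence time is the supremum of the existence times.  The local
    existence time depends only on a bound for the norm of the initial value, so
    a solution whose norm does not tend to infinity at a finite time can be
    continued by gluing.  Nearby solutions stay in one ball on [[0, T]], where the
    truncated flow gives the Lipschitz dependence. *)

(** * Linear combinations *)

(** The differential equation is treated in an arbitrary complete normed module, for a field that is
    Lipschitz on balls. The sequence spaces enter only through their completeness and one difference
    estimate for [Q], which covers both values of [X] at once.

    Truncation lets existence be proved on the whole half line without forming any space of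
    functions: Picard iterates are compared pointwise, against an explicit exponential weight.

    In the statement, derivatives and maximal solutions are values of [epsilon], so they are
    accessible only through uniqueness: of derivatives at limit points of the domain, of solutions
    by Gronwall, of existence times by antisymmetry. Derivatives at end points are one-sided there,
    which hinders gluing, so solutions are first replaced by functions on all of [R] with two-sided
    derivatives. The derivative half of the [C^1] estimate comes from the equation itself, because
    the derivative of a solution is the field along it. *)

Section ModuleExpressions.

Context {V : ModuleSpace R_Ring}.

(** Reflection for abstract vector spaces: vectors are numbered atoms, whereas scalars remain
    arbitrary real terms, so that equality of two expressions reduces to real identities within
    reach of [ring]. *)
Inductive mexp :=
  | MVar (n : nat) | MZero | MPlus (e1 e2 : mexp) | MMinus (e1 e2 : mexp)
  | MOpp (e : mexp) | MScal (c : R) (e : mexp).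

Fixpoint meval (env : list V) (e : mexp) : V :=
  match e with
  | MVar n => nth n env zero
  | MZero => zero
  | MPlus e1 e2 => plus (meval env e1) (meval env e2)
  | MMinus e1 e2 => minus (meval env e1) (meval env e2)
  | MOpp e => opp (meval env e)
  | MScal c e => scal c (meval env e)
  end.

Fixpoint mcoef (e : mexp) (i : nat) : R :=
  match e with
  | MVar n => if Nat.eqb n i then 1 else 0
  | MZero => 0
  | MPlus e1 e2 => mcoef e1 i + mcoef e2 i
  | MMinus e1 e2 => mcoef e1 i - mcoef e2 i
  | MOpp e => - mcoef e i
  | MScal c e => c * mcoef e i
  end.

Fixpoint lin_comb (c : nat -> R) (env : list V) : V :=
  match env with
  | nil => zero
  | v :: env => plus (scal (c O) v) (lin_comb (fun i => c (S i)) env)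
  end.

Fixpoint same_coefs (c d : nat -> R) (env : list V) : Prop :=
  match env with
  | nil => True
  | _ :: env => c O = d O /\ same_coefs (fun i => c (S i)) (fun i => d (S i)) env
  end.

Lemma lin_comb_ext env : forall c d, same_coefs c d env -> lin_comb c env = lin_comb d env.
Proof.
  induction env as [|v env IH]; simpl; intros c d; [reflexivity|].
  intros [-> H]; f_equal; apply IH, H.
Qed.

Lemma lin_comb_plus env : forall c d,
  lin_comb (fun i => c i + d i) env = plus (lin_comb c env) (lin_comb d env).
Proof.
  induction env as [|v env IH]; simpl; intros c d; [symmetry; apply plus_zero_l|].
  rewrite (IH (fun i => c (S i)) (fun i => d (S i))).
  change (c O + d O) with (@plus R_Ring (c O) (d O)).
  rewrite scal_distr_r, <- !plus_assoc; f_equal.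
  rewrite !plus_assoc; f_equal; apply plus_comm.
Qed.

Lemma lin_comb_scal a env : forall c,
  lin_comb (fun i => a * c i) env = scal a (lin_comb c env).
Proof.
  induction env as [|v env IH]; simpl; intros c; [symmetry; apply scal_zero_r|].
  rewrite (IH (fun i => c (S i))), scal_distr_l, scal_assoc; reflexivity.
Qed.

Lemma lin_comb_0 env : lin_comb (fun _ => 0) env = zero.
Proof.
  induction env as [|v env IH]; simpl; [reflexivity|].
  rewrite IH, plus_zero_r; apply (scal_zero_l v).
Qed.

Lemma lin_comb_var env : forall n,
  lin_comb (fun i => if Nat.eqb n i then 1 else 0) env = nth n env zero.
Proof.
  induction env as [|v env IH]; intros [|n]; simpl; try reflexivity.
  - rewrite lin_comb_0, plus_zero_r; apply (scal_one v).
  - rewrite IH; replace (scal 0 v) with (@zero V) by (symmetry; apply (scal_zero_l v)).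
    apply plus_zero_l.
Qed.

Lemma lin_comb_opp env c : lin_comb (fun i => - c i) env = opp (lin_comb c env).
Proof.
  rewrite <- (scal_opp_one (lin_comb c env)), <- lin_comb_scal.
  f_equal; apply functional_extensionality; intros i.
  unfold opp, one; simpl; ring.
Qed.

Lemma meval_lin_comb env e : meval env e = lin_comb (mcoef e) env.
Proof.
  induction e; simpl.
  - symmetry; apply lin_comb_var.
  - symmetry; apply lin_comb_0.
  - now rewrite lin_comb_plus, IHe1, IHe2.
  - change (fun i => mcoef e1 i - mcoef e2 i)
      with (fun i => mcoef e1 i + (fun i => - mcoef e2 i) i).
    now rewrite lin_comb_plus, (lin_comb_opp env (mcoef e2)), <- IHe1, <- IHe2.
  - now rewrite lin_comb_opp, IHe.
  - now rewrite lin_comb_scal, IHe.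
Qed.

Lemma meval_eq env e1 e2 :
  same_coefs (mcoef e1) (mcoef e2) env -> meval env e1 = meval env e2.
Proof. rewrite !meval_lin_comb; apply lin_comb_ext. Qed.

End ModuleExpressions.

Ltac module_index x env :=
  lazymatch env with
  | x :: _ => constr:(O)
  | _ :: ?env => let n := module_index x env in constr:(S n)
  end.

Ltac module_env e env :=
  lazymatch e with
  | @plus _ ?a ?b => let env := module_env a env in module_env b env
  | @minus _ ?a ?b => let env := module_env a env in module_env b env
  | @opp _ ?a => module_env a env
  | @scal _ _ _ ?a => module_env a env
  | @zero _ => env
  | _ => match env with
         | _ => let n := module_index e env in env
         | _ => constr:(e :: env)
         end
  end.

Ltac module_reify e env :=
  lazymatch e with
  | @plus _ ?a ?b =>
      let a := module_reify a env in let b := module_reify b env in constr:(MPlus a b)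
  | @minus _ ?a ?b =>
      let a := module_reify a env in let b := module_reify b env in constr:(MMinus a b)
  | @opp _ ?a => let a := module_reify a env in constr:(MOpp a)
  | @scal _ _ ?c ?a => let a := module_reify a env in constr:(MScal c a)
  | @zero _ => constr:(MZero)
  | _ => let n := module_index e env in constr:(MVar n)
  end.

(* Decides equations between linear combinations in the real vector space [V]
   by comparing coefficients. *)
Ltac module_eq V :=
  lazymatch goal with
  | |- ?a = ?b =>
      let env := module_env a (@nil V) in
      let env := module_env b env in
      let a' := module_reify a env in
      let b' := module_reify b env in
      change (@meval V env a' = @meval V env b');
      apply meval_eq; simpl; repeat split; try ring
  end.

(** * Derivatives relative to a set, and Gronwall *)

(** Compactness of [[0, T]] in the form of an induction. The supremum of the initial segments on
    which [P] holds satisfies [P] by the closedness hypothesis, and the openness hypothesis would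
    push beyond it if it were less than [T]. *)
Lemma real_induction (P : R -> Prop) (T : R) :
  P 0 ->
  (forall s, 0 <= s < T -> (forall r, 0 <= r <= s -> P r) ->
    exists d, 0 < d /\ forall r, s < r < s + d -> r <= T -> P r) ->
  (forall s, 0 < s <= T -> (forall r, 0 <= r < s -> P r) -> P s) ->
  forall s, 0 <= s <= T -> P s.
Proof.
  intros P0 Hopen Hclosed s Hs.
  set (E := fun x => 0 <= x <= T /\ forall r, 0 <= r <= x -> P r).
  assert (E0 : E 0).
  { split; [lra|]; intros r Hr; replace r with 0 by lra; exact P0. }
  destruct (completeness E) as [m [Hub Hlub]].
  - exists T; intros x Hx; apply Hx.
  - exists 0; exact E0.
  - assert (Hm : 0 <= m <= T).
    { split; [apply Hub, E0 | apply Hlub; intros x Hx; apply Hx]. }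
    assert (Hbelow : forall r, 0 <= r < m -> P r).
    { intros r Hr; apply NNPP; intros HP.
      assert (m <= r); [|lra].
      apply Hlub; intros x [Hx1 Hx2]; apply Rnot_lt_le; intros Hlt.
      apply HP, Hx2; lra. }
    assert (HPm : P m).
    { destruct (Req_dec m 0) as [->|Hne]; [exact P0|].
      apply Hclosed; [lra | exact Hbelow]. }
    assert (Hall : forall r, 0 <= r <= m -> P r).
    { intros r Hr; destruct (Req_dec r m) as [->|Hne]; [exact HPm|].
      apply Hbelow; lra. }
    destruct (Rlt_or_le m T) as [Hlt|Hle]; [|apply Hall; lra].
    exfalso; destruct (Hopen m) as [d [Hd Hr]]; [lra | exact Hall |].
    set (x := Rmin T (m + d / 2)).
    assert (Hx1 : x <= T) by apply Rmin_l.
    assert (Hx2 : x <= m + d / 2) by apply Rmin_r.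
    assert (Hx3 : m < x) by (apply Rmin_glb_lt; lra).
    assert (Ex : E x).
    { split; [lra|]; intros r Hr'.
      destruct (Rle_lt_dec r m) as [H1|H1]; [apply Hall; lra|].
      apply Hr; lra. }
    apply Hub in Ex; lra.
Qed.

Lemma le_0_of_le_half_pow (x C : R) : (forall n, x <= C * (1 / 2) ^ n) -> x <= 0.
Proof.
  intros H; apply Rnot_lt_le; intros Hx.
  assert (HC : 0 < C) by (specialize (H O); simpl in H; lra).
  destruct (pow_lt_1_zero (1 / 2)) with (y := x / C) as [N HN].
  - rewrite Rabs_pos_eq; lra.
  - apply Rdiv_lt_0_compat; lra.
  - specialize (HN N (le_n N)); specialize (H N).
    rewrite Rabs_pos_eq in HN by (apply pow_le; lra).
    assert (C * (1 / 2) ^ N < C * (x / C)) by (apply Rmult_lt_compat_l; lra).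
    replace (C * (x / C)) with x in H0 by (field; lra); lra.
Qed.

Section Derivatives.

Context {V : CompleteNormedModule R_AbsRing}.

Implicit Types (f g : R -> V) (D : R -> Prop).

Lemma norm_minus_sym (x y : V) : norm (minus x y) = norm (minus y x).
Proof. rewrite <- norm_opp; f_equal; module_eq V. Qed.

Lemma norm_minus_triangle (x y z : V) :
  norm (minus x z) <= norm (minus x y) + norm (minus y z).
Proof.
  replace (minus x z) with (plus (minus x y) (minus y z)) by module_eq V.
  exact (norm_triangle (minus x y) (minus y z)).
Qed.

Lemma norm_le_plus_minus (x y : V) : norm x <= norm y + norm (minus x y).
Proof.
  replace x with (plus y (minus x y)) at 1 by module_eq V.
  exact (norm_triangle y (minus x y)).
Qed.

Lemma norm_minus_le (x y : V) : norm (minus x y) <= norm x + norm y.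
Proof.
  rewrite <- (norm_opp y); exact (norm_triangle x (opp y)).
Qed.

Lemma norm_minus_le0 (x y : V) : norm (minus x y) <= 0 -> x = y.
Proof.
  intros H; replace x with (plus (minus x y) y) by module_eq V.
  rewrite (norm_eq_zero (minus x y)); [apply plus_zero_l|].
  apply Rle_antisym; [exact H | apply norm_ge_0].
Qed.

(** The axioms of a normed module give only [<=]; the converse is the same inequality for the scalar
    [/ c]. *)
Lemma norm_scal_Rabs (c : R) (x : V) : norm (scal c x) = Rabs c * norm x.
Proof.
  apply Rle_antisym; [exact (norm_scal c x)|].
  destruct (Req_dec c 0) as [->|Hc].
  - rewrite Rabs_R0, Rmult_0_l; apply norm_ge_0.
  - assert (Hx : norm (scal (/ c) (scal c x)) <= / Rabs c * norm (scal c x)).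
    { rewrite <- Rabs_inv; exact (norm_scal (/ c) (scal c x)). }
    replace (scal (/ c) (scal c x)) with x in Hx by (module_eq V; field; exact Hc).
    assert (Hp := Rabs_pos_lt c Hc).
    apply Rmult_le_compat_l with (r := Rabs c) in Hx; [|lra].
    rewrite <- Rmult_assoc, Rinv_r, Rmult_1_l in Hx by lra; exact Hx.
Qed.

(** The epsilon-delta form of [is_derive_on], in which restricting, gluing and translating the
    domain [D] are direct. *)
Definition has_derive D f (t : R) (l : V) : Prop :=
  forall e, 0 < e -> exists d, 0 < d /\ forall s, D s -> Rabs (s - t) < d ->
    norm (minus (minus (f s) (f t)) (scal (s - t) l)) <= e * Rabs (s - t).

Definition limit_point D (t : R) : Prop :=
  forall d, 0 < d -> exists s, D s /\ 0 < Rabs (s - t) < d.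

Definition continuous_within D f (t : R) : Prop :=
  forall e, 0 < e -> exists d, 0 < d /\ forall s, D s -> Rabs (s - t) < d ->
    norm (minus (f s) (f t)) < e.

Lemma is_derive_on_has_derive D f t l :
  D t -> is_derive_on D f t l <-> has_derive D f t l.
Proof.
  intros Dt; split.
  - intros [_ H] e He.
    destruct (H t) with (eps := mkposreal e He) as [d Hd].
    { intros P HP; unfold within; apply filter_imp with (2 := HP); auto. }
    exists d; split; [apply cond_pos|].
    intros s Ds Hs; exact (Hd s Hs Ds).
  - intros H; split; [exact (@is_linear_scal_l R_AbsRing V l)|].
    intros x Hx.
    (* [filterdiff] quantifies over all limits of the filter. As [t] lies in [D], every set of the
       trace filter contains [t], so no other point can be a limit. *)
    assert (x = t) as ->.
    { apply NNPP; intros Hne.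
      assert (Hp : 0 < Rabs (t - x) / 2).
      { assert (0 < Rabs (t - x)) by (apply Rabs_pos_lt; lra); lra. }
      destruct (Hx (ball x (mkposreal _ Hp))) as [d Hd].
      { apply locally_ball. }
      specialize (Hd t (ball_center t d) Dt).
      change (Rabs (t - x) < Rabs (t - x) / 2) in Hd; lra. }
    intros eps; destruct (H eps (cond_pos eps)) as [d [Hd Hs]].
    exists (mkposreal d Hd); intros s Hb Ds; exact (Hs s Ds Hb).
Qed.

Lemma is_derive_has_derive f t l :
  is_derive f t l -> has_derive (fun _ => True) f t l.
Proof.
  intros [_ H] e He.
  destruct (H t) with (eps := mkposreal e He) as [d Hd].
  { intros P HP; exact HP. }
  exists d; split; [apply cond_pos|].
  intros s _ Hs; exact (Hd s Hs).
Qed.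

Lemma continuous_within_filterlim D f t :
  continuous_within D f t -> filterlim f (within D (locally t)) (locally (f t)).
Proof.
  intros H; apply filterlim_locally; intros eps.
  destruct (H eps (cond_pos eps)) as [d [Hd Hs]].
  exists (mkposreal d Hd); intros s Hb Ds.
  exact (norm_compat1 (f t) (f s) eps (Hs s Ds Hb)).
Qed.

Lemma filterlim_continuous_within D f t :
  filterlim f (within D (locally t)) (locally (f t)) -> continuous_within D f t.
Proof.
  intros H e He.
  assert (H' : locally (f t) (ball_norm (f t) (mkposreal e He))).
  { exact (locally_le_locally_norm (f t) _ (locally_norm_ball_norm (f t) _)). }
  destruct (H _ H') as [d Hd].
  exists d; split; [apply cond_pos|]; intros s Ds Hs; exact (Hd s Hs Ds).
Qed.

Lemma continuous_within_continuous f t :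
  continuous_within (fun _ => True) f t <-> continuous f t.
Proof.
  split; intros H.
  - apply continuous_within_filterlim in H.
    intros P HP; destruct (H P HP) as [d Hd]; exists d; intros s Hs; exact (Hd s Hs I).
  - apply filterlim_continuous_within; intros P HP.
    destruct (H P HP) as [d Hd]; exists d; intros s Hs _; exact (Hd s Hs).
Qed.

Lemma continuous_within_local D D' f g t r :
  0 < r -> (forall s, D' s -> Rabs (s - t) < r -> D s /\ g s = f s) -> g t = f t ->
  continuous_within D f t -> continuous_within D' g t.
Proof.
  intros Hr HD Ht H e He; destruct (H e He) as [d [Hd Hs]].
  exists (Rmin d r); split; [apply Rmin_glb_lt; assumption|].
  intros s Ds Hst.
  assert (H1 := Rmin_l d r); assert (H2 := Rmin_r d r).
  destruct (HD s Ds) as [D's Es]; [lra|].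
  rewrite Es, Ht; apply Hs; [exact D's | lra].
Qed.

Lemma has_derive_local D D' f g t l r :
  0 < r -> (forall s, D' s -> Rabs (s - t) < r -> D s /\ g s = f s) -> g t = f t ->
  has_derive D f t l -> has_derive D' g t l.
Proof.
  intros Hr HD Ht H e He; destruct (H e He) as [d [Hd Hs]].
  exists (Rmin d r); split; [apply Rmin_glb_lt; assumption|].
  intros s Ds Hst.
  assert (H1 := Rmin_l d r); assert (H2 := Rmin_r d r).
  destruct (HD s Ds) as [D's Es]; [lra|].
  rewrite Es, Ht; apply Hs; [exact D's | lra].
Qed.

Lemma has_derive_subset D D' f t l :
  (forall s, D' s -> D s) -> has_derive D f t l -> has_derive D' f t l.
Proof.
  intros HD; apply has_derive_local with (r := 1); [lra | | reflexivity].
  intros s Ds _; split; [apply HD, Ds | reflexivity].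
Qed.

Lemma has_derive_union D D' f t l :
  has_derive D f t l -> has_derive D' f t l ->
  has_derive (fun s => D s \/ D' s) f t l.
Proof.
  intros H H' e He.
  destruct (H e He) as [d [Hd Hs]]; destruct (H' e He) as [d' [Hd' Hs']].
  exists (Rmin d d'); split; [apply Rmin_glb_lt; assumption|].
  assert (H1 := Rmin_l d d'); assert (H2 := Rmin_r d d').
  intros s [Ds|Ds] Hst; [apply Hs | apply Hs']; auto; lra.
Qed.

Lemma has_derive_shift D f t l a :
  has_derive D f (t - a) l ->
  has_derive (fun s => D (s - a)) (fun s => f (s - a)) t l.
Proof.
  intros H e He; destruct (H e He) as [d [Hd Hs]].
  exists d; split; [exact Hd|]; intros s Ds Hst.
  replace (s - t) with (s - a - (t - a)) in * by ring; auto.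
Qed.

Lemma has_derive_minus D f g t l m :
  has_derive D f t l -> has_derive D g t m ->
  has_derive D (fun s => minus (f s) (g s)) t (minus l m).
Proof.
  intros H H' e He.
  destruct (H (e / 2)) as [d [Hd Hs]]; [lra|].
  destruct (H' (e / 2)) as [d' [Hd' Hs']]; [lra|].
  exists (Rmin d d'); split; [apply Rmin_glb_lt; assumption|].
  assert (H1 := Rmin_l d d'); assert (H2 := Rmin_r d d').
  intros s Ds Hst; specialize (Hs s Ds ltac:(lra)); specialize (Hs' s Ds ltac:(lra)).
  match goal with |- norm ?x <= _ => replace x with
    (minus (minus (minus (f s) (f t)) (scal (s - t) l))
           (minus (minus (g s) (g t)) (scal (s - t) m))) by module_eq V end.
  eapply Rle_trans; [apply norm_minus_le | lra].
Qed.

Lemma has_derive_norm_le D f t l e :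
  0 < e -> has_derive D f t l -> exists d, 0 < d /\ forall s, D s -> Rabs (s - t) < d ->
    norm (minus (f s) (f t)) <= (norm l + e) * Rabs (s - t).
Proof.
  intros He H; destruct (H e He) as [d [Hd Hs]].
  exists d; split; [exact Hd|]; intros s Ds Hst.
  eapply Rle_trans; [apply norm_le_plus_minus with (y := scal (s - t) l)|].
  rewrite norm_scal_Rabs; specialize (Hs s Ds Hst); lra.
Qed.

Lemma has_derive_continuous_within D f t l :
  has_derive D f t l -> continuous_within D f t.
Proof.
  intros H e He.
  destruct (has_derive_norm_le D f t l 1 ltac:(lra) H) as [d [Hd Hs]].
  assert (Hl := norm_ge_0 l).
  assert (Hq : 0 < e / (norm l + 1)) by (apply Rdiv_lt_0_compat; lra).
  exists (Rmin d (e / (norm l + 1))); split; [apply Rmin_glb_lt; assumption|].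
  assert (H1 := Rmin_l d (e / (norm l + 1))); assert (H2 := Rmin_r d (e / (norm l + 1))).
  intros s Ds Hst; eapply Rle_lt_trans; [apply Hs; [exact Ds | lra]|].
  apply Rlt_le_trans with ((norm l + 1) * (e / (norm l + 1))).
  - apply Rmult_lt_compat_l; lra.
  - apply Req_le; field; lra.
Qed.

Lemma has_derive_unique D f t l m :
  limit_point D t -> has_derive D f t l -> has_derive D f t m -> l = m.
Proof.
  intros Hacc H H'; apply norm_minus_le0, Rnot_lt_le; intros Hp.
  set (p := norm (minus l m)) in *.
  destruct (H (p / 4)) as [d [Hd Hs]]; [lra|].
  destruct (H' (p / 4)) as [d' [Hd' Hs']]; [lra|].
  destruct (Hacc (Rmin d d')) as [s [Ds Hst]]; [apply Rmin_glb_lt; assumption|].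
  assert (H1 := Rmin_l d d'); assert (H2 := Rmin_r d d').
  specialize (Hs s Ds ltac:(lra)); specialize (Hs' s Ds ltac:(lra)).
  assert (Hn : norm (scal (s - t) (minus l m)) <= p / 2 * Rabs (s - t)).
  { replace (scal (s - t) (minus l m)) with
      (minus (minus (minus (f s) (f t)) (scal (s - t) m))
             (minus (minus (f s) (f t)) (scal (s - t) l))) by module_eq V.
    eapply Rle_trans; [apply norm_minus_le | lra]. }
  rewrite norm_scal_Rabs in Hn; fold p in Hn; nra.
Qed.

(** Real induction on the boundedness over [[0, s]]: a bound on an earlier segment and a bound near
    [s] together cover [[0, s]]. *)
Lemma continuous_within_bounded f T :
  (forall s, 0 <= s <= T -> continuous_within (Icc0 T) f s) ->
  exists M, 0 <= M /\ forall s, 0 <= s <= T -> norm (f s) <= M.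
Proof.
  intros Hc.
  destruct (Rlt_or_le T 0) as [HT|HT]; [exists 0; split; [lra | intros; lra]|].
  assert (Hloc : forall s, 0 <= s <= T -> exists d, 0 < d /\
            forall r, 0 <= r <= T -> Rabs (r - s) < d -> norm (f r) <= norm (f s) + 1).
  { intros s Hs; destruct (Hc s Hs 1) as [d [Hd Hr]]; [lra|].
    exists d; split; [exact Hd|]; intros r Hr1 Hr2.
    specialize (Hr r Hr1 Hr2).
    eapply Rle_trans; [apply norm_le_plus_minus with (y := f s) | lra]. }
  assert (H : exists M, forall r, 0 <= r <= T -> norm (f r) <= M).
  { apply (real_induction (fun s => exists M, forall r, 0 <= r <= s -> norm (f r) <= M) T);
      [| | | lra].
    - exists (norm (f 0)); intros r Hr; replace r with 0 by lra; lra.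
    - intros s Hs HP; destruct (HP s) as [M HM]; [lra|].
      destruct (Hloc s) as [d [Hd Hd']]; [lra|].
      exists d; split; [exact Hd|]; intros r Hr HrT.
      exists (Rmax M (norm (f s) + 1)); intros q Hq.
      destruct (Rle_lt_dec q s).
      + apply Rle_trans with (2 := Rmax_l _ _), HM; lra.
      + apply Rle_trans with (2 := Rmax_r _ _), Hd'; [lra|].
        rewrite Rabs_pos_eq; lra.
    - intros s Hs HP; destruct (Hloc s) as [d [Hd Hd']]; [lra|].
      destruct (HP (Rmax 0 (s - d / 2))) as [M HM].
      { split; [apply Rmax_l | apply Rmax_lub_lt; lra]. }
      exists (Rmax M (norm (f s) + 1)); intros q Hq.
      destruct (Rle_lt_dec q (Rmax 0 (s - d / 2))).
      + apply Rle_trans with (2 := Rmax_l _ _), HM; lra.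
      + apply Rle_trans with (2 := Rmax_r _ _), Hd'; [lra|].
        assert (Hq' := Rmax_r 0 (s - d / 2)).
        rewrite Rabs_left1; lra. }
  destruct H as [M HM]; exists M; split; [|exact HM].
  apply Rle_trans with (norm (f 0)); [apply norm_ge_0 | apply HM; lra].
Qed.

(* Only right derivatives enter: the bound [A e^{(L+1)s}] with [A] slightly
   larger than [norm (f 0)] propagates to the right of [s] because it grows
   strictly faster than [f] can. *)
Lemma gronwall f (f' : R -> V) T L :
  0 <= L ->
  (forall s, 0 <= s <= T -> has_derive (Icc0 T) f s (f' s)) ->
  (forall s, 0 <= s <= T -> norm (f' s) <= L * norm (f s)) ->
  forall t, 0 <= t <= T -> norm (f t) <= norm (f 0) * exp ((L + 1) * t).
Proof.
  intros HL Hd Hf'.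
  assert (Hexp : forall s, 0 <= s -> 1 <= exp ((L + 1) * s)).
  { intros s Hs; assert (H := exp_ineq1_le ((L + 1) * s)); nra. }
  assert (Hmain : forall A, norm (f 0) < A -> forall t, 0 <= t <= T ->
            norm (f t) <= A * exp ((L + 1) * t)).
  { intros A HA.
    assert (HA0 : 0 < A) by (assert (H := norm_ge_0 (f 0)); lra).
    apply (real_induction (fun t => norm (f t) <= A * exp ((L + 1) * t)) T).
    - rewrite Rmult_0_r, exp_0; lra.
    - intros s Hs HP; specialize (HP s ltac:(lra)).
      destruct (has_derive_norm_le _ _ _ _ A HA0 (Hd s ltac:(lra))) as [d [Hd0 Hr]].
      exists d; split; [exact Hd0|]; intros r Hrs HrT.
      specialize (Hr r ltac:(unfold Icc0; lra)).
      rewrite Rabs_pos_eq in Hr by lra; specialize (Hr ltac:(lra)).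
      assert (H1 := norm_le_plus_minus (f r) (f s)).
      assert (H2 := Hf' s ltac:(lra)).
      assert (H3 := Hexp s ltac:(lra)).
      assert (H4 := exp_ineq1_le ((L + 1) * (r - s))).
      replace ((L + 1) * r) with ((L + 1) * s + (L + 1) * (r - s)) by ring.
      rewrite exp_plus, <- Rmult_assoc.
      set (E := exp ((L + 1) * s)) in *.
      apply Rle_trans with (A * E * (1 + (L + 1) * (r - s)));
        [|apply Rmult_le_compat_l; [nra | exact H4]].
      assert (H5 : (norm (f' s) + A) * (r - s) <= (L * (A * E) + A * E) * (r - s)).
      { apply Rmult_le_compat_r; [lra|]; nra. }
      nra.
    - intros s Hs HP; apply Rnot_lt_le; intros Hlt.
      destruct (has_derive_continuous_within _ _ _ _ (Hd s ltac:(lra))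
                  (norm (f s) - A * exp ((L + 1) * s)) ltac:(lra)) as [d [Hd0 Hr]].
      set (r := Rmax 0 (s - d / 2)).
      assert (Hr0 : 0 <= r < s) by (split; [apply Rmax_l | apply Rmax_lub_lt; lra]).
      assert (Hr1 : s - d / 2 <= r) by apply Rmax_r.
      specialize (Hr r ltac:(unfold Icc0; lra)).
      rewrite Rabs_left1 in Hr by lra; specialize (Hr ltac:(lra)).
      specialize (HP r Hr0).
      assert (Hle : A * exp ((L + 1) * r) <= A * exp ((L + 1) * s)).
      { apply Rmult_le_compat_l; [lra|]; apply Rlt_le, exp_increasing; nra. }
      assert (H1 := norm_le_plus_minus (f s) (f r)).
      rewrite (norm_minus_sym (f s)) in H1; lra. }
  intros t Ht; apply Rnot_lt_le; intros Hlt.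
  assert (HE := exp_pos ((L + 1) * t)).
  set (E := exp ((L + 1) * t)) in *.
  (* This [A] makes [A * E] the midpoint between [norm (f 0) * E] and the supposedly larger
     [norm (f t)]. *)
  specialize (Hmain (norm (f 0) + (norm (f t) - norm (f 0) * E) / (2 * E))).
  assert (Hp : 0 < (norm (f t) - norm (f 0) * E) / (2 * E)).
  { apply Rdiv_lt_0_compat; lra. }
  specialize (Hmain ltac:(lra) t Ht); fold E in Hmain.
  replace ((norm (f 0) + (norm (f t) - norm (f 0) * E) / (2 * E)) * E)
    with (norm (f 0) * E + (norm (f t) - norm (f 0) * E) / 2) in Hmain
    by (field; lra).
  lra.
Qed.

End Derivatives.

(** * Globally Lipschitz fields *)

Section GlobalFlow.

Context {V : CompleteNormedModule R_AbsRing}.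

Lemma norm_telescope_half_pow (x : nat -> V) C :
  0 <= C -> (forall n, norm (minus (x (S n)) (x n)) <= C * (1 / 2) ^ n) ->
  forall n k, norm (minus (x (n + k)%nat) (x n)) <= 2 * C * (1 / 2) ^ n.
Proof.
  intros HC H n k.
  (* The extra factor [1 - (1 / 2) ^ k] records the partial geometric sum, without which the
     induction on [k] would not close. *)
  assert (Hk : norm (minus (x (n + k)%nat) (x n))
               <= 2 * C * (1 / 2) ^ n * (1 - (1 / 2) ^ k)).
  { induction k as [|k IH].
    - rewrite Nat.add_0_r; replace (minus (x n) (x n)) with (@zero V) by module_eq V.
      replace (norm (@zero V)) with 0 by (symmetry; exact (@norm_zero _ V)); simpl; lra.
    - rewrite Nat.add_succ_r.
      eapply Rle_trans; [apply norm_minus_triangle with (y := x (n + k)%nat)|].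
      specialize (H (n + k)%nat); rewrite pow_add in H; simpl pow; lra. }
  assert (0 <= (1 / 2) ^ k) by (apply pow_le; lra).
  assert (0 <= (1 / 2) ^ n) by (apply pow_le; lra).
  assert (0 <= 2 * C * (1 / 2) ^ n) by (apply Rmult_le_pos; lra).
  nra.
Qed.

Lemma geometric_limit (x : nat -> V) C :
  0 <= C -> (forall n, norm (minus (x (S n)) (x n)) <= C * (1 / 2) ^ n) ->
  exists y, forall n, norm (minus y (x n)) <= 2 * C * (1 / 2) ^ n.
Proof.
  intros HC H; assert (Ht := norm_telescope_half_pow x C HC H).
  set (F := filtermap x eventually).
  assert (PF : ProperFilter F).
  { apply filtermap_proper_filter, eventually_filter. }
  assert (CF : cauchy F).
  { intros eps.
    assert (HN : exists N, 2 * C * (1 / 2) ^ N < eps).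
    { apply NNPP; intros Hn.
      assert (eps / 1 <= 0); [|assert (He := cond_pos eps); lra].
      apply le_0_of_le_half_pow with (2 * C); intros n.
      apply Rnot_lt_le; intros Hlt; apply Hn; exists n; lra. }
    destruct HN as [N HN]; exists (x N), N; intros n Hn.
    apply (norm_compat1 (x N) (x n)).
    replace n with (N + (n - N))%nat by lia.
    eapply Rle_lt_trans; [apply Ht | exact HN]. }
  assert (Hlim : exists y : V, forall eps : posreal, F (ball y eps)).
  { exists (lim F); exact (complete_cauchy F PF CF). }
  destruct Hlim as [y Hlim].
  exists y; intros n; apply Rnot_lt_le; intros Hlt.
  set (gap := norm (minus y (x n)) - 2 * C * (1 / 2) ^ n).
  assert (Hfac := @norm_factor_gt_0 _ V).
  (* A ball of the uniform structure controls the norm only up to [norm_factor], hence the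
     division. *)
  assert (He : 0 < gap / (@norm_factor _ V)) by (apply Rdiv_lt_0_compat; [unfold gap; lra | exact Hfac]).
  destruct (Hlim (mkposreal _ He)) as [N HN].
  specialize (HN (n + N)%nat ltac:(lia)).
  apply (norm_compat2 y (x (n + N)%nat)) in HN; cbn [pos] in HN.
  replace (@norm_factor _ V * (gap / @norm_factor _ V)) with gap in HN by (field; lra).
  specialize (Ht n N).
  assert (H1 := norm_minus_triangle y (x (n + N)%nat) (x n)).
  rewrite (norm_minus_sym y (x (n + N)%nat)) in H1; assert (HN2 : norm (minus (x (n + N)%nat) y) < gap) by exact HN.
  unfold gap in *; lra.
Qed.

(** The origin of the ratio 1/2: integrating [L] times the weight [exp (2 L s)] returns half of the
    weight, less a constant. *)
Lemma is_RInt_exp_2 (L B t : R) : 0 < L ->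
  is_RInt (fun s => L * (B * exp (2 * L * s))) 0 t (B / 2 * exp (2 * L * t) - B / 2).
Proof.
  intros HL.
  assert (H : is_RInt (fun s => L * (B * exp (2 * L * s))) 0 t
                (minus (B / 2 * exp (2 * L * t)) (B / 2 * exp (2 * L * 0)))).
  { apply (is_RInt_derive (fun s => B / 2 * exp (2 * L * s))).
    - intros s _; auto_derive; [exact I | field].
    - intros s _; apply (ex_derive_continuous (fun s => L * (B * exp (2 * L * s)))).
      auto_derive; exact I. }
  rewrite Rmult_0_r, exp_0 in H.
  replace (B / 2 * exp (2 * L * t) - B / 2) with
    (minus (B / 2 * exp (2 * L * t)) (B / 2 * 1)); [exact H|].
  unfold minus, plus, opp; simpl; ring.
Qed.

Context (G : V -> V) (L : R).
Hypothesis L_pos : 0 < L.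
Hypothesis G_Lip : forall u v : V, norm (minus (G u) (G v)) <= L * norm (minus u v).

Lemma Lipschitz_continuous_comp (u : R -> V) :
  (forall t, continuous u t) -> forall t, continuous (fun s => G (u s)) t.
Proof.
  intros Hu t; apply continuous_within_continuous; intros e He.
  destruct (proj2 (continuous_within_continuous u t) (Hu t) (e / L)) as [d [Hd Hs]].
  { apply Rdiv_lt_0_compat; lra. }
  exists d; split; [exact Hd|]; intros s Ds Hst.
  eapply Rle_lt_trans; [apply G_Lip|].
  specialize (Hs s Ds Hst).
  apply Rmult_lt_compat_l with (r := L) in Hs; [|lra].
  replace (L * (e / L)) with e in Hs by (field; lra); exact Hs.
Qed.

Lemma continuous_ex_RInt (g : R -> V) a b : (forall t, continuous g t) -> ex_RInt g a b.
Proof. intros Hg; apply (@ex_RInt_continuous V); intros z _; apply Hg. Qed.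

Lemma is_derive_primitive (g : R -> V) v : (forall t, continuous g t) ->
  forall t, is_derive (fun s => plus v (RInt g 0 s)) t (g t).
Proof.
  intros Hg t.
  replace (g t) with (plus zero (g t)) by apply plus_zero_l.
  apply (@is_derive_plus R_AbsRing V); [apply (@is_derive_const R_AbsRing V)|].
  apply (is_derive_RInt g (fun s => RInt g 0 s) 0 t); [|apply Hg].
  apply filter_forall; intros s; apply (@RInt_correct V), continuous_ex_RInt, Hg.
Qed.

(** The upper limit [Rabs t] extends the usual iterates evenly from the half line to all of [R], so
    that continuity can be stated and used without a one-sided version at 0. *)
Fixpoint picard (v : V) (n : nat) : R -> V :=
  match n with
  | O => fun _ => v
  | S n => fun t => plus v (RInt (fun s => G (picard v n s)) 0 (Rabs t))
  end.

Lemma continuous_picard v n t : continuous (picard v n) t.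
Proof.
  revert t; induction n as [|n IH]; intros t; simpl; [apply continuous_const|].
  apply (continuous_comp Rabs (fun r => plus v (RInt (fun s => G (picard v n s)) 0 r))).
  - apply continuous_Rabs.
  - apply (@ex_derive_continuous R_AbsRing V).
    exists (G (picard v n (Rabs t))).
    apply (is_derive_primitive (fun s => G (picard v n s))).
    apply Lipschitz_continuous_comp, IH.
Qed.

(* The weight [exp (2 L t)] makes the Picard map a contraction of ratio 1/2 on
   the whole half line. *)
Lemma picard_step v : exists B, 0 <= B /\ forall n t,
  norm (minus (picard v (S n) t) (picard v n t)) <= B * exp (2 * L * Rabs t) * (1 / 2) ^ n.
Proof.
  (* The first increment is at most [|t| * norm (G v) = B * (2 L |t|)], and
     [2 L |t| <= exp (2 L |t|)]. *)
  exists (norm (G v) / (2 * L)).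
  assert (HB : 0 <= norm (G v) / (2 * L)).
  { apply Rmult_le_pos; [apply norm_ge_0 | apply Rlt_le, Rinv_0_lt_compat; lra]. }
  set (B := norm (G v) / (2 * L)) in *.
  split; [exact HB|]; intros n; induction n as [|n IH]; intros t;
    assert (Ht := Rabs_pos t).
  - simpl; rewrite Rmult_1_r.
    replace (minus (plus v (RInt (fun _ => G v) 0 (Rabs t))) v)
      with (RInt (fun _ => G v) 0 (Rabs t)) by module_eq V.
    apply Rle_trans with ((Rabs t - 0) * norm (G v)).
    + apply norm_RInt_le_const with (fun _ => G v); [exact Ht | intros; lra |].
      apply (@RInt_correct V), continuous_ex_RInt; intros; apply continuous_const.
    + assert (He := exp_ineq1_le (2 * L * Rabs t)).
      replace (norm (G v)) with (B * (2 * L)) by (unfold B; field; lra).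
      nra.
  - assert (Hc := fun n => Lipschitz_continuous_comp _ (continuous_picard v n)).
    change (picard v (S (S n)) t)
      with (plus v (RInt (fun s => G (picard v (S n) s)) 0 (Rabs t))).
    change (picard v (S n) t) with (plus v (RInt (fun s => G (picard v n s)) 0 (Rabs t))).
    match goal with |- norm (minus (plus v ?a) (plus v ?b)) <= _ =>
      replace (minus (plus v a) (plus v b)) with (minus a b) by module_eq V end.
    eapply Rle_trans.
    + apply norm_RInt_le with
        (f := fun s => minus (G (picard v (S n) s)) (G (picard v n s)))
        (g := fun s => L * (B * (1 / 2) ^ n * exp (2 * L * s)))
        (1 := Ht) (4 := is_RInt_exp_2 L _ _ L_pos).
      * intros s Hs; eapply Rle_trans; [apply G_Lip|].
        apply Rmult_le_compat_l; [lra|].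
        specialize (IH s); rewrite (Rabs_pos_eq s) in IH by lra.
        eapply Rle_trans; [exact IH | right; ring].
      * apply (@is_RInt_minus V); apply (@RInt_correct V), continuous_ex_RInt, Hc.
    + assert (0 <= (1 / 2) ^ n) by (apply pow_le; lra).
      assert (0 <= B * (1 / 2) ^ n) by (apply Rmult_le_pos; lra).
      simpl pow; set (E := exp (2 * L * Rabs t)) in *; nra.
Qed.

(** Near a given [t] the weight is bounded by its value at [|t| + 1], so the convergence is locally
    uniform and continuity passes from the iterates to the limit. *)
Lemma picard_limit v : exists (u : R -> V) (C : R), 0 <= C /\
  (forall n t, norm (minus (u t) (picard v n t)) <= C * exp (2 * L * Rabs t) * (1 / 2) ^ n) /\
  forall t, continuous u t.
Proof.
  destruct (picard_step v) as [B [HB Hstep]].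
  assert (Hlim : forall t, exists y, forall n,
            norm (minus y (picard v n t)) <= 2 * (B * exp (2 * L * Rabs t)) * (1 / 2) ^ n).
  { intros t; apply geometric_limit; [|intros n; apply Hstep].
    apply Rmult_le_pos; [exact HB | apply Rlt_le, exp_pos]. }
  set (u := fun t => epsilon (inhabits zero) (fun y => forall n,
         norm (minus y (picard v n t)) <= 2 * (B * exp (2 * L * Rabs t)) * (1 / 2) ^ n)).
  assert (Hu : forall n t, norm (minus (u t) (picard v n t))
                 <= 2 * B * exp (2 * L * Rabs t) * (1 / 2) ^ n).
  { intros n t; eapply Rle_trans;
      [apply (epsilon_spec (inhabits zero) _ (Hlim t)) | right; ring]. }
  exists u, (2 * B); split; [lra|]; split; [exact Hu|].
  intros t; apply continuous_within_continuous; intros e He.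
  set (C := 2 * B * exp (2 * L * (Rabs t + 1))).
  assert (Hun : forall n s, Rabs (s - t) < 1 ->
            norm (minus (u s) (picard v n s)) <= C * (1 / 2) ^ n).
  { intros n s Hs; eapply Rle_trans; [apply Hu|].
    apply Rmult_le_compat_r; [apply pow_le; lra|].
    apply Rmult_le_compat_l; [lra|].
    assert (Hs' := Rabs_triang_inv s t).
    destruct (Req_dec (Rabs s) (Rabs t + 1)) as [->|Hne]; [lra|].
    apply Rlt_le, exp_increasing, Rmult_lt_compat_l; lra. }
  assert (HN : exists n, C * (1 / 2) ^ n < e / 3).
  { apply NNPP; intros Hn.
    assert (e / 3 <= 0); [|lra].
    apply le_0_of_le_half_pow with C; intros n.
    apply Rnot_lt_le; intros Hlt; apply Hn; exists n; exact Hlt. }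
  destruct HN as [n Hn].
  destruct (proj2 (continuous_within_continuous _ t) (continuous_picard v n t) (e / 3))
    as [d [Hd Hs]]; [lra|].
  exists (Rmin d 1); split; [apply Rmin_glb_lt; lra|].
  assert (H1 := Rmin_l d 1); assert (H2 := Rmin_r d 1).
  intros s _ Hst; specialize (Hs s I ltac:(lra)).
  assert (Hus := Hun n s ltac:(lra)).
  assert (Hut := Hun n t ltac:(rewrite Rminus_diag, Rabs_R0; lra)).
  rewrite norm_minus_sym in Hut.
  assert (T1 := norm_minus_triangle (u s) (picard v n s) (u t)).
  assert (T2 := norm_minus_triangle (picard v n s) (picard v n t) (u t)).
  lra.
Qed.

(** The last clause bounds the distance travelled by speed times time; from it [local_solution]
    obtains an existence time that is uniform in the initial value. *)
Lemma global_flow v : exists u : R -> V,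
  u 0 = v /\
  (forall t, 0 <= t -> has_derive (fun _ => True) u t (G (u t))) /\
  (forall B, (forall x : V, norm (G x) <= B) ->
     forall t, 0 <= t -> norm (minus (u t) v) <= B * t).
Proof.
  destruct (picard_limit v) as [u [C [HC [Hu Hc]]]].
  assert (HcG := Lipschitz_continuous_comp _ Hc).
  assert (HcP := fun n => Lipschitz_continuous_comp _ (continuous_picard v n)).
  set (w := fun t => plus v (RInt (fun s => G (u s)) 0 t)).
  assert (Hw : forall t, 0 <= t -> u t = w t).
  { intros t Ht; apply norm_minus_le0.
    apply le_0_of_le_half_pow
      with (C * exp (2 * L * t) + C / 2 * exp (2 * L * t)); intros n.
    assert (H1 := Hu (S n) t).
    assert (H2 : norm (minus (picard v (S n) t) (w t))
                 <= C / 2 * exp (2 * L * t) * (1 / 2) ^ n).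
    { simpl; unfold w; rewrite (Rabs_pos_eq t Ht).
      match goal with |- norm (minus (plus v ?a) (plus v ?b)) <= _ =>
        replace (minus (plus v a) (plus v b)) with (minus a b) by module_eq V end.
      eapply Rle_trans.
      + apply norm_RInt_le with
          (f := fun s => minus (G (picard v n s)) (G (u s)))
          (g := fun s => L * (C * (1 / 2) ^ n * exp (2 * L * s)))
          (1 := Ht) (4 := is_RInt_exp_2 L _ _ L_pos).
        * intros s Hs; eapply Rle_trans; [apply G_Lip|].
          apply Rmult_le_compat_l; [lra|].
          rewrite norm_minus_sym; specialize (Hu n s).
          rewrite (Rabs_pos_eq s) in Hu by lra.
          eapply Rle_trans; [exact Hu | right; ring].
        * apply (@is_RInt_minus V); apply (@RInt_correct V), continuous_ex_RInt; auto.
      + assert (0 <= (1 / 2) ^ n) by (apply pow_le; lra).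
        assert (0 <= C * (1 / 2) ^ n) by (apply Rmult_le_pos; lra).
        nra. }
    rewrite (Rabs_pos_eq t Ht) in H1; simpl pow in H1.
    assert (0 <= C * exp (2 * L * t) * (1 / 2) ^ n).
    { apply Rmult_le_pos; [|apply pow_le; lra].
      apply Rmult_le_pos; [exact HC | apply Rlt_le, exp_pos]. }
    eapply Rle_trans; [apply norm_minus_triangle with (y := picard v (S n) t)|]; lra. }
  (* The primitive [w] is returned instead of [u]: they agree for [t >= 0] only, and [w] is
     differentiable on both sides of 0, whereas [u] is a limit of even functions. *)
  exists w; split; [|split].
  - unfold w; replace (RInt (fun s => G (u s)) 0 0) with (@zero V)
      by (symmetry; apply (RInt_point 0 (fun s => G (u s)))).
    apply plus_zero_r.
  - intros t Ht; rewrite <- (Hw t Ht).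
    apply is_derive_has_derive, (is_derive_primitive (fun s => G (u s))), HcG.
  - intros B HB t Ht; unfold w.
    replace (minus (plus v (RInt (fun s => G (u s)) 0 t)) v)
      with (RInt (fun s => G (u s)) 0 t) by module_eq V.
    replace (B * t) with ((t - 0) * B) by ring.
    apply norm_RInt_le_const with (fun s => G (u s)); [exact Ht | auto |].
    apply (@RInt_correct V), continuous_ex_RInt, HcG.
Qed.

(** For equal initial values this is also the uniqueness of solutions of the truncated equation. *)
Lemma Lipschitz_dependence (T : R) (u w : R -> V) :
  (forall s, 0 <= s <= T -> has_derive (Icc0 T) u s (G (u s))) ->
  (forall s, 0 <= s <= T -> has_derive (Icc0 T) w s (G (w s))) ->
  forall t, 0 <= t <= T ->
    norm (minus (u t) (w t)) <= norm (minus (u 0) (w 0)) * exp ((L + 1) * t).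
Proof.
  intros Hu Hw.
  apply (gronwall (fun t => minus (u t) (w t)) (fun t => minus (G (u t)) (G (w t)))); [lra | |].
  - intros s Hs; apply has_derive_minus; auto.
  - intros s Hs; apply G_Lip.
Qed.

End GlobalFlow.

(** * Maximal solutions for locally Lipschitz fields *)

Lemma limit_point_Icc0 T t : 0 < T -> Icc0 T t -> limit_point (Icc0 T) t.
Proof.
  unfold Icc0; intros HT Ht d Hd.
  destruct (Rlt_or_le t T) as [H|H].
  - set (h := Rmin (d / 2) (T - t)).
    assert (0 < h) by (apply Rmin_glb_lt; lra).
    assert (h <= d / 2) by apply Rmin_l; assert (h <= T - t) by apply Rmin_r.
    exists (t + h); replace (t + h - t) with h by ring; rewrite Rabs_pos_eq; lra.
  - set (h := Rmin (d / 2) t).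
    assert (0 < h) by (apply Rmin_glb_lt; lra).
    assert (h <= d / 2) by apply Rmin_l; assert (h <= t) by apply Rmin_r.
    exists (t - h); replace (t - h - t) with (- h) by ring; rewrite Rabs_left; lra.
Qed.

Lemma limit_point_subset (D D' : R -> Prop) t :
  (forall s, D s -> D' s) -> limit_point D t -> limit_point D' t.
Proof.
  intros HD H d Hd; destruct (H d Hd) as [s [Ds Hs]]; exists s; auto.
Qed.

Lemma Ico0_between tau t : Ico0 tau t -> exists T, t < T /\ Ico0 tau T.
Proof.
  unfold Ico0; intros [H0 H]; destruct tau as [tau| |]; simpl in *.
  - exists ((t + tau) / 2); split; [lra | split; [lra | simpl; lra]].
  - exists (t + 1); split; [lra | split; [lra | exact I]].
  - contradiction.
Qed.

Lemma Ico0_Icc0 tau T s : Ico0 tau T -> Icc0 T s -> Ico0 tau s.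
Proof.
  unfold Ico0, Icc0; intros [H0 H] Hs; split; [lra|].
  apply Rbar_le_lt_trans with T; [simpl; lra | exact H].
Qed.

Section MaximalSolutions.

Context {V : CompleteNormedModule R_AbsRing}.

Definition radial_retraction (r : R) (v : V) : V := scal (r / Rmax r (norm v)) v.

Lemma norm_radial_retraction r v : 0 < r -> norm (radial_retraction r v) <= r.
Proof.
  intros Hr; unfold radial_retraction; rewrite norm_scal_Rabs.
  assert (H1 := Rmax_l r (norm v)); assert (H2 := Rmax_r r (norm v)).
  rewrite Rabs_pos_eq.
  - apply Rle_trans with (r / Rmax r (norm v) * Rmax r (norm v)).
    + apply Rmult_le_compat_l; [|exact H2].
      apply Rlt_le, Rdiv_lt_0_compat; lra.
    + right; field; lra.
  - apply Rlt_le, Rdiv_lt_0_compat; lra.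
Qed.

Lemma radial_retraction_id r v : 0 < r -> norm v <= r -> radial_retraction r v = v.
Proof.
  intros Hr Hv; unfold radial_retraction; rewrite Rmax_left by exact Hv.
  module_eq V; field; lra.
Qed.

Lemma Rabs_Rmax_minus r a b : Rabs (Rmax r a - Rmax r b) <= Rabs (a - b).
Proof.
  unfold Rmax; destruct (Rle_dec r a), (Rle_dec r b); unfold Rabs;
    repeat destruct Rcase_abs; lra.
Qed.

Lemma Rabs_norm_minus (u v : V) : Rabs (norm u - norm v) <= norm (minus u v).
Proof.
  assert (H1 := norm_le_plus_minus u v); assert (H2 := norm_le_plus_minus v u).
  rewrite norm_minus_sym in H2; apply Rabs_le; lra.
Qed.

(** With [a = Rmax r (norm u)] and [b = Rmax r (norm v)], the difference is
    [(r/a) (u - v) + (r/a - r/b) v]. Each summand has norm at most [norm (minus u v)], the second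
    because [|a - b| <= norm (minus u v)], [r <= a] and [norm v <= b]; hence the constant 2. *)
Lemma radial_retraction_Lipschitz r u v : 0 < r ->
  norm (minus (radial_retraction r u) (radial_retraction r v)) <= 2 * norm (minus u v).
Proof.
  intros Hr; unfold radial_retraction.
  assert (Hu1 := Rmax_l r (norm u)).
  assert (Hv1 := Rmax_l r (norm v)); assert (Hv2 := Rmax_r r (norm v)).
  assert (Hab : Rabs (Rmax r (norm u) - Rmax r (norm v)) <= norm (minus u v)).
  { eapply Rle_trans; [apply Rabs_Rmax_minus | apply Rabs_norm_minus]. }
  set (a := Rmax r (norm u)) in *; set (b := Rmax r (norm v)) in *.
  match goal with |- norm ?x <= _ => replace x
    with (plus (scal (r / a) (minus u v)) (scal (r / a - r / b) v)) by module_eq V end.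
  eapply Rle_trans; [apply (@norm_triangle _ V)|].
  rewrite !norm_scal_Rabs.
  assert (Hn := norm_ge_0 (minus u v)); assert (Hn' := norm_ge_0 v).
  assert (Hra : 0 <= r / a <= 1).
  { split; [apply Rlt_le, Rdiv_lt_0_compat; lra|].
    apply Rmult_le_reg_r with a; [lra|]; replace (r / a * a) with r by (field; lra); lra. }
  assert (Hvb : 0 <= norm v / b <= 1).
  { split; [apply Rmult_le_pos; [lra | apply Rlt_le, Rinv_0_lt_compat; lra]|].
    apply Rmult_le_reg_r with b; [lra|].
    replace (norm v / b * b) with (norm v) by (field; lra); lra. }
  assert (H2 : Rabs (r / a - r / b) * norm v <= norm (minus u v)).
  { replace (r / a - r / b) with (r / a * ((b - a) / b)) by (field; lra).
    unfold Rdiv at 2.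
    rewrite !Rabs_mult, Rabs_inv, (Rabs_pos_eq (r / a)), (Rabs_pos_eq b), Rabs_minus_sym
      by lra.
    replace (r / a * (Rabs (a - b) * / b) * norm v)
      with (Rabs (a - b) * (r / a * (norm v / b))) by (field; lra).
    assert (H3 := Rabs_pos (a - b)).
    assert (0 <= r / a * (norm v / b) <= 1) by nra.
    nra. }
  rewrite (Rabs_pos_eq (r / a)) by lra.
  assert (H4 : r / a * norm (minus u v) <= norm (minus u v)) by nra.
  replace (2 * norm (minus u v)) with (norm (minus u v) + norm (minus u v)) by ring.
  exact (Rplus_le_compat _ _ _ _ H4 H2).
Qed.

Context (F : V -> V).
Hypothesis F_Lip : forall M, exists L, 0 < L /\ forall u v : V,
  norm u <= M -> norm v <= M -> norm (minus (F u) (F v)) <= L * norm (minus u v).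

Lemma truncated_field r : 0 < r -> exists (G : V -> V) (L B : R), 0 < L /\ 0 < B /\
  (forall u v : V, norm (minus (G u) (G v)) <= L * norm (minus u v)) /\
  (forall u : V, norm (G u) <= B) /\
  (forall u : V, norm u <= r -> G u = F u).
Proof.
  intros Hr; destruct (F_Lip r) as [L [HL HF]].
  set (z := zero : V).
  assert (Hz : norm z = 0) by exact (@norm_zero _ V).
  exists (fun v => F (radial_retraction r v)), (2 * L), (norm (F z) + L * r).
  assert (H0 := norm_ge_0 (F z)).
  assert (HLr : 0 < L * r) by (apply Rmult_lt_0_compat; lra).
  split; [lra|]; split; [lra|]; split; [|split].
  - intros u v; eapply Rle_trans; [apply HF; apply norm_radial_retraction; exact Hr|].
    rewrite (Rmult_comm 2 L), Rmult_assoc.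
    apply Rmult_le_compat_l; [lra | apply radial_retraction_Lipschitz, Hr].
  - intros u; assert (Hu := norm_radial_retraction r u Hr).
    assert (H := HF (radial_retraction r u) z Hu ltac:(rewrite Hz; lra)).
    assert (H1 := norm_le_plus_minus (F (radial_retraction r u)) (F z)).
    assert (H2 := norm_minus_le (radial_retraction r u) z); rewrite Hz in H2.
    assert (L * norm (minus (radial_retraction r u) z) <= L * r)
      by (apply Rmult_le_compat_l; lra).
    lra.
  - intros u Hu; rewrite radial_retraction_id by assumption; reflexivity.
Qed.

(** The field truncated at radius [M + 1] has norm at most [B], so a solution starting in the ball
    of radius [M] takes at least time [/ B] to cross the shell of width 1, and until then the
    truncation is invisible. *)
Lemma local_solution M : 0 <= M -> exists h, 0 < h /\ forall v : V, norm v <= M ->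
  exists u : R -> V, u 0 = v /\
    forall t, 0 <= t <= h -> has_derive (fun _ => True) u t (F (u t)).
Proof.
  intros HM; destruct (truncated_field (M + 1)) as [G [L [B [HL [HB [HG [HGB HGF]]]]]]];
    [lra|].
  exists (/ B); split; [apply Rinv_0_lt_compat, HB|]; intros v Hv.
  destruct (global_flow G L HL HG v) as [u [Hu0 [Hu Hub]]].
  exists u; split; [exact Hu0|]; intros t Ht.
  rewrite <- HGF; [apply Hu; lra|].
  assert (H1 := norm_le_plus_minus (u t) v); assert (H2 := Hub B HGB t ltac:(lra)).
  assert (B * t <= B * / B) by (apply Rmult_le_compat_l; lra).
  rewrite Rinv_r in H by lra; lra.
Qed.

Lemma solution_unique T (u w : R -> V) :
  (forall s, 0 <= s <= T -> has_derive (Icc0 T) u s (F (u s))) ->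
  (forall s, 0 <= s <= T -> has_derive (Icc0 T) w s (F (w s))) ->
  u 0 = w 0 -> forall t, 0 <= t <= T -> u t = w t.
Proof.
  intros Hu Hw H0 t Ht.
  destruct (continuous_within_bounded u T) as [Mu [HMu Bu]].
  { intros s Hs; apply has_derive_continuous_within with (1 := Hu s Hs). }
  destruct (continuous_within_bounded w T) as [Mw [HMw Bw]].
  { intros s Hs; apply has_derive_continuous_within with (1 := Hw s Hs). }
  destruct (truncated_field (Mu + Mw + 1)) as [G [L [B [HL [HB [HG [HGB HGF]]]]]]]; [lra|].
  apply norm_minus_le0.
  eapply Rle_trans; [apply (Lipschitz_dependence G L HL HG T u w)|]; trivial.
  - intros s Hs; rewrite HGF; [apply Hu, Hs | specialize (Bu s Hs); lra].
  - intros s Hs; rewrite HGF; [apply Hw, Hs | specialize (Bw s Hs); lra].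
  - rewrite H0; replace (minus (w 0) (w 0)) with (@zero V) by module_eq V.
    replace (norm (@zero V)) with 0 by (symmetry; exact (@norm_zero _ V)); lra.
Qed.

(* The derivatives are two-sided, also at the end points: this makes solutions
   easy to glue and extend, and loses nothing by [solution_two_sided]. *)
Definition solves_upto (v : V) (T : R) (u : R -> V) : Prop :=
  u 0 = v /\ forall t, 0 <= t <= T -> has_derive (fun _ => True) u t (F (u t)).

Lemma solves_upto_le v T T' u : T' <= T -> solves_upto v T u -> solves_upto v T' u.
Proof. intros HT [H0 H]; split; [exact H0|]; intros t Ht; apply H; lra. Qed.

Lemma solves_upto_Icc0 v T u t : solves_upto v T u -> 0 <= t <= T ->
  has_derive (Icc0 T) u t (F (u t)).
Proof.
  intros [_ H] Ht; apply has_derive_subset with (2 := H t Ht); trivial.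
Qed.

(** The global flow of a suitable truncation agrees with [g] on [[0, T]] and has two-sided
    derivatives at both ends. *)
Lemma solution_two_sided v T (g : R -> V) : g 0 = v ->
  (forall s, 0 <= s <= T -> has_derive (Icc0 T) g s (F (g s))) ->
  exists u, solves_upto v T u /\ forall s, 0 <= s <= T -> u s = g s.
Proof.
  intros H0 Hg.
  destruct (continuous_within_bounded g T) as [M [HM Bg]].
  { intros s Hs; apply has_derive_continuous_within with (1 := Hg s Hs). }
  destruct (truncated_field (M + 1)) as [G [L [B [HL [HB [HG [HGB HGF]]]]]]]; [lra|].
  destruct (global_flow G L HL HG v) as [u [Hu0 [Hu Hub]]].
  assert (E : forall s, 0 <= s <= T -> u s = g s).
  { intros s Hs; apply norm_minus_le0.
    eapply Rle_trans; [apply (Lipschitz_dependence G L HL HG T u g)|]; trivial.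
    - intros r Hr; apply has_derive_subset with (D := fun _ => True); [trivial|].
      apply Hu; lra.
    - intros r Hr; rewrite HGF; [apply Hg, Hr | specialize (Bg r Hr); lra].
    - rewrite Hu0, H0; replace (minus v v) with (@zero V) by module_eq V.
      replace (norm (@zero V)) with 0 by (symmetry; exact (@norm_zero _ V)); lra. }
  exists u; split; [split; [exact Hu0|] | exact E].
  intros s Hs; rewrite <- HGF; [apply Hu; lra|].
  rewrite E by exact Hs; specialize (Bg s Hs); lra.
Qed.

Definition solves (v : V) (tau : Rbar) (f : R -> V) : Prop :=
  Rbar_lt 0 tau /\ f 0 = v /\
  forall t, Ico0 tau t -> has_derive (Ico0 tau) f t (F (f t)).

(** The comparison is with all solutions and not, as in [is_maximal_solution], with extensions of
    [f] alone; by [solves_agree] a longer solution always is an extension. *)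
Definition solves_maximally (v : V) (tau : Rbar) (f : R -> V) : Prop :=
  solves v tau f /\ forall sigma g, solves v sigma g -> Rbar_le sigma tau.

Lemma solves_Icc0 v tau f T : solves v tau f -> Ico0 tau T ->
  forall s, 0 <= s <= T -> has_derive (Icc0 T) f s (F (f s)).
Proof.
  intros [_ [_ H]] HT s Hs; apply has_derive_subset with (D := Ico0 tau).
  - intros r Hr; apply Ico0_Icc0 with (1 := HT), Hr.
  - apply H, Ico0_Icc0 with (1 := HT), Hs.
Qed.

Lemma solves_agree v tau sigma f g : solves v tau f -> solves v sigma g ->
  forall t, Ico0 tau t -> Ico0 sigma t -> f t = g t.
Proof.
  intros Hf Hg t H1 H2; apply (solution_unique t f g).
  - apply solves_Icc0 with (1 := Hf) (2 := H1).
  - apply solves_Icc0 with (1 := Hg) (2 := H2).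
  - destruct Hf as [_ [-> _]]; destruct Hg as [_ [-> _]]; reflexivity.
  - destruct H1; lra.
Qed.

Lemma solves_upto_solves v T u : 0 < T -> solves_upto v T u -> solves v T u.
Proof.
  intros HT [H0 H]; split; [exact HT|]; split; [exact H0|].
  intros t [Ht1 Ht2]; simpl in Ht2; apply has_derive_subset with (D := fun _ => True); [trivial|].
  apply H; lra.
Qed.

Lemma exists_solves_maximally v : exists tau f, solves_maximally v tau f.
Proof.
  set (E := fun T => exists u, solves_upto v T u).
  set (tau := Lub_Rbar E).
  destruct (Lub_Rbar_correct E) as [Hub Hlub]; fold tau in Hub, Hlub.
  assert (HE : forall t, Ico0 tau t -> exists T, t < T /\ E T).
  { intros t [Ht1 Ht2]; apply NNPP; intros Hn.
    apply (Rbar_lt_not_le _ _ Ht2), Hlub; intros T HT.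
    apply Rbar_not_lt_le; intros Hlt; apply Hn; exists T; split; [exact Hlt | exact HT]. }
  (* A separate solution up to [t] is chosen for every [t] and evaluated at [t]; uniqueness, in
     [Hf], makes these choices fit together. *)
  set (f := fun t => epsilon (inhabits (fun _ => zero)) (fun u => solves_upto v t u) t).
  assert (Hf : forall T u, solves_upto v T u -> forall t, 0 <= t <= T -> f t = u t).
  { intros T u Hu t Ht; unfold f.
    assert (Hs : solves_upto v t
              (epsilon (inhabits (fun _ => zero)) (fun u => solves_upto v t u))).
    { apply epsilon_spec; exists u; apply solves_upto_le with (2 := Hu); lra. }
    set (w := epsilon _ _) in *.
    apply (solution_unique t w u); [| | | lra].
    - intros s Hs'; apply solves_upto_Icc0 with (1 := Hs) (2 := Hs').
    - intros s Hs'; apply solves_upto_Icc0 with v; [|exact Hs'].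
      apply solves_upto_le with (2 := Hu); lra.
    - destruct Hs as [-> _]; destruct Hu as [-> _]; reflexivity. }
  assert (Hpos : Rbar_lt 0 tau).
  { destruct (local_solution (norm v)) as [h [Hh Hloc]]; [apply norm_ge_0|].
    destruct (Hloc v (Rle_refl _)) as [u Hu].
    apply Rbar_lt_le_trans with h; [exact Hh|]; apply Hub; exists u; exact Hu. }
  exists tau, f; split; [split; [exact Hpos | split]|].
  - destruct (HE 0) as [T [HT [u Hu]]]; [split; [lra | exact Hpos]|].
    rewrite (Hf T u Hu 0) by lra; apply Hu.
  - intros t Ht; destruct (HE t Ht) as [T [HT [u Hu]]]; destruct Ht as [Ht1 Ht2].
    assert (Et : f t = u t) by (apply (Hf T u Hu); lra); rewrite Et.
    apply has_derive_local with (D := fun _ => True) (f := u) (r := T - t);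
      [lra | | exact Et |].
    + intros s [Hs1 _] Hs; split; [exact I|]; apply (Hf T u Hu).
      assert (H := Rle_abs (s - t)); lra.
    + apply Hu; lra.
  - intros sigma g Hg; apply Rbar_not_lt_le; intros Hlt.
    (* Since [0 < tau < sigma], [tau] is finite; a real [T] between [tau] and [sigma] will be an
       element of [E] above its supremum. *)
    assert (HT : exists T : R, Rbar_lt tau T /\ Ico0 sigma T).
    { destruct tau as [tau'| |]; simpl in Hpos; [|destruct sigma; contradiction | contradiction].
      destruct (Ico0_between sigma tau') as [T [H1 H2]]; [split; [simpl in *; lra | exact Hlt]|].
      exists T; split; [exact H1 | exact H2]. }
    destruct HT as [T [H1 H2]].
    destruct (solution_two_sided v T g) as [u [Hu _]].
    + apply Hg.
    + apply solves_Icc0 with (1 := Hg) (2 := H2).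
    + apply (Rbar_lt_not_le _ _ H1), Hub; exists u; exact Hu.
Qed.

(** The continuation time [h] serves the whole ball of radius [M], so the norm exceeds [M] at every
    time close enough to [tau]: this yields a limit and not merely unboundedness. *)
Lemma maximal_solution_blowup v (tau : R) f : solves_maximally v tau f ->
  filterlim (fun t => norm (f t)) (at_left tau) (Rbar_locally p_infty).
Proof.
  intros [[Hpos [H0 Hf]] Hmax]; simpl in Hpos.
  intros P [M HM].
  destruct (local_solution (Rmax M 0)) as [h [Hh Hloc]]; [apply Rmax_r|].
  (* Within this distance to the left of [tau], [t + h] exceeds [tau] and [t] remains positive. *)
  assert (Hd : 0 < Rmin h tau) by (apply Rmin_glb_lt; assumption).
  assert (Hd1 := Rmin_l h tau); assert (Hd2 := Rmin_r h tau).
  exists (mkposreal _ Hd); intros t Hb Ht; apply HM.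
  change (Rabs (t - tau) < Rmin h tau) in Hb.
  rewrite Rabs_left in Hb by lra.
  apply Rnot_le_lt; intros Hle.
  destruct (Hloc (f t)) as [u [Hu0 Hu]].
  { apply Rle_trans with (1 := Hle), Rmax_l. }
  set (w := fun s => if Rle_dec s t then f s else u (s - t)).
  assert (Wl : forall s, s <= t -> w s = f s).
  { intros s Hs; unfold w; destruct (Rle_dec s t); [reflexivity | lra]. }
  assert (Wr : forall s, t <= s -> w s = u (s - t)).
  { intros s Hs; unfold w; destruct (Rle_dec s t); [|reflexivity].
    replace s with t by lra; rewrite Rminus_diag, Hu0; reflexivity. }
  apply (Rlt_not_le (t + h) tau); [lra|].
  apply (Hmax (t + h) w); split; [simpl; lra|]; split; [rewrite Wl by lra; exact H0|].
  intros s [Hs1 Hs2]; simpl in Hs2.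
  assert (Dl : s <= t -> has_derive (fun r => Ico0 (t + h) r /\ r <= t) w s (F (w s))).
  { intros Hst; rewrite Wl by exact Hst.
    apply has_derive_local with (D := Ico0 tau) (f := f) (r := 1); [lra | | apply Wl, Hst |].
    - intros r [[Hr1 _] Hr2] _; split; [split; simpl; lra | apply Wl, Hr2].
    - apply Hf; split; simpl; lra. }
  assert (Dr : t <= s -> has_derive (fun r => t <= r) w s (F (w s))).
  { intros Hst; rewrite Wr by exact Hst.
    apply has_derive_local with (D := fun _ => True) (f := fun r => u (r - t)) (r := 1);
      [lra | | apply Wr, Hst |].
    - intros r Hr _; split; [exact I | apply Wr, Hr].
    - apply (has_derive_shift (fun _ => True) u s _ t), Hu; lra. }
  (* Away from [t] only one piece of [w] is visible locally. At [t] both pieces have the derivative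
     [F (w t)], which is therefore the derivative relative to the union. *)
  destruct (Rtotal_order s t) as [Hst|[Hst|Hst]].
  - apply has_derive_local with (3 := eq_refl) (4 := Dl ltac:(lra)) (r := t - s); [lra|].
    intros r Hr1 Hr2; assert (H := Rle_abs (r - s)); repeat split; try apply Hr1; lra.
  - apply has_derive_subset with (2 := has_derive_union _ _ _ _ _ (Dl ltac:(lra)) (Dr ltac:(lra))).
    intros r Hr; destruct (Rle_dec r t); [left; split; assumption | right; lra].
  - apply has_derive_local with (3 := eq_refl) (4 := Dr ltac:(lra)) (r := s - t); [lra|].
    intros r Hr1 Hr2; apply Rabs_def2 in Hr2; split; [lra | reflexivity].
Qed.

(** The second estimate, for [F] along the two solutions, is the one for their derivatives. *)
Lemma maximal_solution_dependence v tau f T :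
  solves v tau f -> 0 < T -> Rbar_lt T tau ->
  exists delta L, 0 < delta /\ 0 < L /\
    (forall w : V, norm (minus w v) <= delta -> forall sigma g, solves_maximally w sigma g ->
       Rbar_lt T sigma) /\
    (forall (w1 w2 : V) s1 s2 g1 g2,
       norm (minus w1 v) <= delta -> norm (minus w2 v) <= delta ->
       solves_maximally w1 s1 g1 -> solves_maximally w2 s2 g2 ->
       forall t, 0 <= t <= T ->
         norm (minus (g1 t) (g2 t)) <= L * norm (minus w1 w2) /\
         norm (minus (F (g1 t)) (F (g2 t))) <= L * norm (minus w1 w2)).
Proof.
  intros Hf HT HTtau.
  assert (HI : Ico0 tau T) by (split; [lra | exact HTtau]).
  assert (HfT := solves_Icc0 _ _ _ _ Hf HI).
  destruct (continuous_within_bounded f T) as [M [HM Bf]].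
  { intros s Hs; apply has_derive_continuous_within with (1 := HfT s Hs). }
  (* One unit of room is for the deviation from [f] on [[0, T]], at most [/ E * E]; the other lets
     the perturbed solution run past [T], as the strict inequality [T < sigma] demands. *)
  destruct (truncated_field (M + 2)) as [G [L [B [HL [HB [HG [HGB HGF]]]]]]]; [lra|].
  set (E := exp ((L + 1) * T)).
  assert (HE : 0 < E) by apply exp_pos.
  assert (HE' : forall t, t <= T -> exp ((L + 1) * t) <= E).
  { intros t Ht; destruct (Req_dec t T) as [->|Hne]; [apply Rle_refl|].
    apply Rlt_le, exp_increasing, Rmult_lt_compat_l; lra. }
  assert (Hflow : forall w : V, norm (minus w v) <= / E -> exists u : R -> V, u 0 = w /\
            (forall t, 0 <= t -> has_derive (fun _ => True) u t (G (u t))) /\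
            (forall t, 0 <= t <= T -> norm (u t) <= M + 1)).
  { intros w Hw; destruct (global_flow G L HL HG w) as [u [Hu0 [Hu _]]].
    exists u; split; [exact Hu0|]; split; [exact Hu|]; intros t Ht.
    assert (Hd : norm (minus (u t) (f t)) <= norm (minus (u 0) (f 0)) * exp ((L + 1) * t)).
    { apply (Lipschitz_dependence G L HL HG T u f); [| | exact Ht].
      - intros s Hs; apply has_derive_subset with (D := fun _ => True); [trivial|].
        apply Hu; lra.
      - intros s Hs; rewrite HGF; [apply HfT, Hs | specialize (Bf s Hs); lra]. }
    rewrite Hu0 in Hd; destruct Hf as [_ [Hf0 _]]; rewrite Hf0 in Hd.
    assert (H1 := norm_le_plus_minus (u t) (f t)); assert (H2 := Bf t Ht).
    assert (H3 := HE' t ltac:(lra)).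
    assert (H4 := norm_ge_0 (minus w v)).
    assert (H5 : norm (minus w v) * exp ((L + 1) * t) <= / E * E).
    { apply Rmult_le_compat; try assumption; apply Rlt_le, exp_pos. }
    rewrite Rinv_l in H5 by lra; lra. }
  assert (Hflow' : forall w : V, norm (minus w v) <= / E -> exists u : R -> V, u 0 = w /\
            (forall t, 0 <= t -> has_derive (fun _ => True) u t (G (u t))) /\
            exists T', T < T' /\ forall t, 0 <= t <= T' -> norm (u t) <= M + 2).
  { intros w Hw; destruct (Hflow w Hw) as [u [Hu0 [Hu HuM]]].
    exists u; split; [exact Hu0|]; split; [exact Hu|].
    destruct (has_derive_continuous_within _ _ _ _ (Hu T ltac:(lra)) 1) as [d [Hd Hs]]; [lra|].
    exists (T + d / 2); split; [lra|]; intros t Ht.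
    destruct (Rle_lt_dec t T) as [H|H]; [specialize (HuM t ltac:(lra)); lra|].
    specialize (Hs t I ltac:(rewrite Rabs_pos_eq; lra)).
    assert (H1 := norm_le_plus_minus (u t) (u T)).
    specialize (HuM T ltac:(lra)); lra. }
  assert (Hmaxflow : forall (w : V) sigma g, norm (minus w v) <= / E -> solves_maximally w sigma g ->
            Rbar_lt T sigma /\ g 0 = w /\
            (forall t, 0 <= t <= T -> norm (g t) <= M + 2) /\
            (forall t, 0 <= t <= T -> has_derive (Icc0 T) g t (G (g t)))).
  { intros w sigma g Hw [Hg Hgmax].
    destruct (Hflow' w Hw) as [u [Hu0 [Hu [T' [HT' HuM]]]]].
    assert (Hus : solves w T' u).
    { apply solves_upto_solves; [lra|]; split; [exact Hu0|].
      intros t Ht; rewrite <- HGF; [apply Hu; lra | apply HuM, Ht]. }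
    assert (HTs : Rbar_lt T sigma).
    { apply Rbar_lt_le_trans with T'; [exact HT' | apply (Hgmax T' u Hus)]. }
    assert (Hgu : forall t, 0 <= t <= T -> g t = u t).
    { intros t Ht; apply (solves_agree w sigma T' g u Hg Hus); split; try lra.
      - apply Rbar_le_lt_trans with T; [simpl; lra | exact HTs].
      - simpl; lra. }
    split; [exact HTs|]; split; [apply Hg|].
    assert (HgM : forall t, 0 <= t <= T -> norm (g t) <= M + 2).
    { intros t Ht; rewrite Hgu by exact Ht; apply HuM; lra. }
    split; [exact HgM|]; intros t Ht; rewrite HGF by (apply HgM, Ht).
    apply (solves_Icc0 w sigma); [exact Hg | split; [lra | exact HTs] | exact Ht]. }
  (* [E] bounds the growth of the distance of two solutions and [L * E] that of their derivatives;
     [(L + 1) * E] dominates both. *)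
  exists (/ E), ((L + 1) * E).
  split; [apply Rinv_0_lt_compat, HE|].
  split; [apply Rmult_lt_0_compat; lra|]; split.
  - intros w Hw sigma g Hg; apply (Hmaxflow w sigma g Hw Hg).
  - intros w1 w2 s1 s2 g1 g2 H1 H2 M1 M2 t Ht.
    destruct (Hmaxflow _ _ _ H1 M1) as [_ [I1 [B1 D1]]].
    destruct (Hmaxflow _ _ _ H2 M2) as [_ [I2 [B2 D2]]].
    assert (Hdep := Lipschitz_dependence G L HL HG T g1 g2 D1 D2 t Ht).
    rewrite I1, I2 in Hdep.
    assert (H3 := HE' t ltac:(lra)); assert (H4 := norm_ge_0 (minus w1 w2)).
    assert (H5 : norm (minus (g1 t) (g2 t)) <= E * norm (minus w1 w2)).
    { eapply Rle_trans; [exact Hdep|]; rewrite Rmult_comm.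
      apply Rmult_le_compat_r; assumption. }
    assert (H6 : 0 <= E * norm (minus w1 w2)) by (apply Rmult_le_pos; lra).
    split; [nra|].
    rewrite <- !HGF by auto; eapply Rle_trans; [apply HG|]; nra.
Qed.

End MaximalSolutions.

(** * Summation over the integers, completeness, and the collision operator *)

(** The window from [- (N + 1)] to [N] is asymmetric in order to take equally many terms from each
    of the two series in [sumZ]. *)
Fixpoint partial_sumZ (u : Z -> R) (N : nat) : R :=
  match N with
  | O => u 0%Z + u (- 1)%Z
  | S n => partial_sumZ u n + (u (Z.of_nat (S n)) + u (- Z.of_nat (S (S n)))%Z)
  end.

Lemma partial_sumZ_sum_n u N : partial_sumZ u N =
  sum_n (fun n => u (Z.of_nat n)) N + sum_n (fun n => u (- Z.of_nat (S n))%Z) N.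
Proof.
  induction N as [|N IH]; simpl partial_sumZ.
  - rewrite !sum_O; reflexivity.
  - rewrite IH, !sum_Sn; unfold plus; simpl; ring.
Qed.

Lemma partial_sumZ_le u v N : (forall k, u k <= v k) -> partial_sumZ u N <= partial_sumZ v N.
Proof.
  intros H; induction N as [|N IH]; cbn [partial_sumZ]; repeat apply Rplus_le_compat; auto.
Qed.

Lemma partial_sumZ_plus u v N :
  partial_sumZ (fun k => u k + v k) N = partial_sumZ u N + partial_sumZ v N.
Proof. induction N as [|N IH]; cbn [partial_sumZ]; [ring | rewrite IH; ring]. Qed.

Lemma sum_n_nonneg (a : nat -> R) N : (forall n, 0 <= a n) -> 0 <= sum_n a N.
Proof.
  intros H; induction N as [|N IH]; [rewrite sum_O; apply H|].
  rewrite sum_Sn; unfold plus; simpl; specialize (H (S N)); lra.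
Qed.

Lemma sum_n_incr (a : nat -> R) N : (forall n, 0 <= a n) -> sum_n a N <= sum_n a (S N).
Proof. intros H; rewrite sum_Sn; unfold plus; simpl; specialize (H (S N)); lra. Qed.

Lemma ex_series_of_bounded (a : nat -> R) B :
  (forall n, 0 <= a n) -> (forall N, sum_n a N <= B) -> ex_series a.
Proof.
  intros Ha HB.
  destruct (ex_finite_lim_seq_incr (sum_n a) B) as [l Hl]; [|exact HB | exists l; exact Hl].
  intros n; apply sum_n_incr, Ha.
Qed.

Lemma is_lim_seq_partial_sumZ u : ex_sumZ u -> is_lim_seq (partial_sumZ u) (sumZ u).
Proof.
  intros [Hp Hn].
  apply is_lim_seq_ext with (fun N =>
    sum_n (fun n => u (Z.of_nat n)) N + sum_n (fun n => u (- Z.of_nat (S n))%Z) N).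
  - intros N; symmetry; apply partial_sumZ_sum_n.
  - apply is_lim_seq_plus'; [exact (Series_correct _ Hp) | exact (Series_correct _ Hn)].
Qed.

Lemma sumZ_of_bounded u B : (forall k, 0 <= u k) -> (forall N, partial_sumZ u N <= B) ->
  ex_sumZ u /\ sumZ u <= B.
Proof.
  intros Hu HB.
  assert (E : ex_sumZ u).
  { split; apply ex_series_of_bounded with B; try (intros n; apply Hu); intros N;
      specialize (HB N); rewrite partial_sumZ_sum_n in HB;
      assert (H1 := sum_n_nonneg (fun n => u (Z.of_nat n)) N (fun n => Hu _));
      assert (H2 := sum_n_nonneg (fun n => u (- Z.of_nat (S n))%Z) N (fun n => Hu _)); lra. }
  split; [exact E|].
  apply (is_lim_seq_le (partial_sumZ u) (fun _ => B) (sumZ u) B);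
    [exact HB | apply is_lim_seq_partial_sumZ, E | apply is_lim_seq_const].
Qed.

Lemma partial_sumZ_le_sumZ u N : (forall k, 0 <= u k) -> ex_sumZ u -> partial_sumZ u N <= sumZ u.
Proof.
  intros Hu E; apply is_lim_seq_incr_compare; [apply is_lim_seq_partial_sumZ, E|].
  intros n; cbn [partial_sumZ].
  assert (H1 := Hu (Z.of_nat (S n))); assert (H2 := Hu (- Z.of_nat (S (S n)))%Z); lra.
Qed.

(** The shift only moves the term [u (-1)] from the series over negative integers to the other
    one. *)
Lemma ex_sumZ_shift_pred u :
  ex_sumZ u -> ex_sumZ (fun k => u (k - 1)%Z) /\ sumZ (fun k => u (k - 1)%Z) = sumZ u.
Proof.
  intros [Hp Hn].
  assert (Ep : ex_series (fun n => u (Z.of_nat n - 1)%Z)).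
  { apply ex_series_incr_1, ex_series_ext with (2 := Hp).
    intros n; f_equal; lia. }
  assert (En : ex_series (fun n => u (- Z.of_nat (S n) - 1)%Z)).
  { apply ex_series_incr_1 in Hn; apply ex_series_ext with (2 := Hn).
    intros n; f_equal; lia. }
  split; [split; assumption|]; unfold sumZ.
  rewrite (Series_incr_1 (fun n => u (Z.of_nat n - 1)%Z)) by exact Ep.
  rewrite (Series_incr_1 (fun n => u (- Z.of_nat (S n))%Z)) by exact Hn.
  rewrite (Series_ext (fun k => u (Z.of_nat (S k) - 1)%Z) (fun k => u (Z.of_nat k)))
    by (intros n; f_equal; lia).
  rewrite (Series_ext (fun n => u (- Z.of_nat (S n) - 1)%Z) (fun k => u (- Z.of_nat (S (S k)))%Z))
    by (intros n; f_equal; lia).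
  replace (Z.of_nat 0 - 1)%Z with (- Z.of_nat 1)%Z by reflexivity; ring.
Qed.

Lemma ex_sumZ_shift_succ u :
  ex_sumZ u -> ex_sumZ (fun k => u (k + 1)%Z) /\ sumZ (fun k => u (k + 1)%Z) = sumZ u.
Proof.
  intros [Hp Hn].
  assert (E : ex_sumZ (fun k => u (k + 1)%Z)).
  { split.
    - apply ex_series_incr_1 in Hp; apply ex_series_ext with (2 := Hp).
      intros n; f_equal; lia.
    - apply ex_series_incr_1, ex_series_ext with (2 := Hn).
      intros n; f_equal; lia. }
  split; [exact E|].
  rewrite <- (proj2 (ex_sumZ_shift_pred _ E)).
  apply sumZ_ext; intros k; f_equal; lia.
Qed.

Lemma ex_sumZ_Rabs u : ex_sumZ (fun k => Rabs (u k)) -> ex_sumZ u.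
Proof. intros [Hp Hn]; split; apply ex_series_Rabs; assumption. Qed.

Lemma Rabs_sumZ_le u : ex_sumZ (fun k => Rabs (u k)) -> Rabs (sumZ u) <= sumZ (fun k => Rabs (u k)).
Proof.
  intros [Hp Hn]; unfold sumZ; eapply Rle_trans; [apply Rabs_triang|].
  apply Rplus_le_compat; apply Series_Rabs; assumption.
Qed.

(** * Completeness of the weighted sequence spaces *)

Section Completeness.

Context (X : lspace).

Lemma Rabs_coef_le_norm (f : elt X) k : weight X k * Rabs (f k) <= elt_norm X f.
Proof.
  exact (sumZ_ge_term _ k (wabs_ge0 X f) (coef_summable f)).
Qed.

Lemma coordinate_limit (F : (elt X -> Prop) -> Prop) : ProperFilter F ->
  cauchy (T := elt_UniformSpace X) F ->
  exists c : Z -> R, forall k e, 0 < e -> F (fun f => weight X k * Rabs (f k - c k) < e).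
Proof.
  intros PF CF.
  assert (H : forall k, exists ck : R, forall e, 0 < e ->
            F (fun f => weight X k * Rabs (f k - ck) < e)).
  { intros k; set (Fk := filtermap (fun f : elt X => f k) F).
    assert (PFk : ProperFilter Fk) by (apply filtermap_proper_filter, PF).
    assert (CFk : cauchy (T := R_UniformSpace) Fk).
    { intros eps; destruct (CF eps) as [x Hx]; exists (x k).
      apply filter_imp with (2 := Hx); intros f Hf.
      change (Rabs (f k - x k) < eps); eapply Rle_lt_trans; [|exact Hf].
      eapply Rle_trans; [|apply (Rabs_coef_le_norm (minus f x) k)].
      change (minus f x k) with (f k - x k).
      assert (Hw := weight_ge_1 X k); assert (Ha := Rabs_pos (f k - x k)); nra. }
    assert (Hl : exists l : R, forall eps : posreal, Fk (ball l eps)).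
    { exists (lim (T := R_CompleteSpace) Fk); exact (complete_cauchy (T := R_CompleteSpace) Fk PFk CFk). }
    destruct Hl as [l Hl]; exists l; intros e He.
    assert (Hw := weight_ge_1 X k).
    assert (He' : 0 < e / weight X k) by (apply Rdiv_lt_0_compat; lra).
    assert (Hk : F (fun f => Rabs (f k - l) < e / weight X k))
      by exact (Hl (mkposreal _ He')).
    apply filter_imp with (2 := Hk); intros f Hf.
    apply Rmult_lt_compat_l with (r := weight X k) in Hf; [|lra].
    replace (weight X k * (e / weight X k)) with e in Hf by (field; lra); exact Hf. }
  exists (fun k => epsilon (inhabits 0) (fun ck => forall e, 0 < e ->
            F (fun f => weight X k * Rabs (f k - ck) < e))).
  intros k; exact (epsilon_spec (inhabits 0) _ (H k)).
Qed.

(** A Fatou argument. If the ball of radius [e] around [x] belongs to the filter, it contains some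
    [f] arbitrarily close to the coordinatewise limit [c] on a given finite window, so all partial
    sums of the norm of [x - c] are at most [e]. This gives both the summability of [c] and the
    convergence. *)
Lemma elt_cauchy_limit (F : (elt X -> Prop) -> Prop) : ProperFilter F ->
  cauchy (T := elt_UniformSpace X) F ->
  exists c : elt X, forall eps : posreal, F (elt_ball X c eps).
Proof.
  intros PF CF; destruct (coordinate_limit F PF CF) as [c Hc].
  assert (FF : Filter F) by apply PF.
  assert (Hpart : forall N e, 0 < e ->
            F (fun f => partial_sumZ (fun k => weight X k * Rabs (f k - c k)) N < e)).
  { induction N as [|N IH]; intros e He.
    - apply (@filter_imp _ F FF) with (2 := @filter_and _ F FF _ _ (Hc 0%Z (e / 2) ltac:(lra))
                                    (Hc (- 1)%Z (e / 2) ltac:(lra))).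
      intros f [H1 H2]; cbn [partial_sumZ]; lra.
    - apply (@filter_imp _ F FF) with (2 := @filter_and _ F FF _ _ (IH (e / 3) ltac:(lra))
        (@filter_and _ F FF _ _ (Hc (Z.of_nat (S N)) (e / 3) ltac:(lra))
                        (Hc (- Z.of_nat (S (S N)))%Z (e / 3) ltac:(lra)))).
      intros f [H1 [H2 H3]]; cbn [partial_sumZ]; lra. }
  assert (Hx : forall (x : elt X) e, F (elt_ball X x e) ->
            ex_sumZ (fun k => weight X k * Rabs (x k - c k)) /\
            sumZ (fun k => weight X k * Rabs (x k - c k)) <= e).
  { intros x e He; apply sumZ_of_bounded; [intros k; apply (wabs_ge0 X (fun k => x k - c k))|].
    intros N; apply Rnot_lt_le; intros Hlt.
    destruct (filter_ex _ (@filter_and _ F FF _ _ He (Hpart N _ (proj2 (Rlt_0_minus _ _) Hlt)))) as [f [H1 H2]].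
    unfold elt_ball in H1.
    assert (H3 := partial_sumZ_le_sumZ _ N (wabs_ge0 X (minus f x)) (coef_summable (minus f x))).
    change (sumZ (fun k => weight X k * Rabs (minus f x k))) with (elt_norm X (minus f x)) in H3.
    assert (H4 : partial_sumZ (fun k => weight X k * Rabs (x k - c k)) N <=
                 partial_sumZ (fun k => weight X k * Rabs (minus f x k)) N
                 + partial_sumZ (fun k => weight X k * Rabs (f k - c k)) N).
    { rewrite <- partial_sumZ_plus; apply partial_sumZ_le; intros k.
      change (minus f x k) with (f k - x k).
      assert (Hw := weight_ge_1 X k).
      rewrite <- Rmult_plus_distr_l, (Rabs_minus_sym (f k) (x k)).
      apply Rmult_le_compat_l; [lra|].
      replace (x k - c k) with ((x k - f k) + (f k - c k)) by ring; apply Rabs_triang. }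
    lra. }
  assert (Hc_summable : ex_sumZ (fun k => weight X k * Rabs (c k))).
  { destruct (CF (mkposreal 1 Rlt_0_1)) as [x H].
    destruct (Hx x 1 H) as [Hs _].
    apply ex_sumZ_le with (2 := ex_sumZ_plus _ _ (coef_summable x) Hs).
    intros k; assert (Hw := weight_ge_1 X k); split; [apply wabs_ge0|].
    rewrite <- Rmult_plus_distr_l; apply Rmult_le_compat_l; [lra|].
    replace (c k) with (x k + - (x k - c k)) at 1 by ring.
    eapply Rle_trans; [apply Rabs_triang|]; rewrite Rabs_Ropp; lra. }
  exists (Elt c Hc_summable); intros eps.
  assert (He : 0 < eps / 2) by (assert (H := cond_pos eps); lra).
  destruct (CF (mkposreal _ He)) as [x H].
  apply (@filter_imp _ F FF) with (2 := H); intros f Hf.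
  replace (pos eps) with (eps / 2 + eps / 2) by field.
  assert (Hn := proj2 (Hx x (eps / 2) H)).
  change (elt_norm X (minus f x) < eps / 2) in Hf.
  unfold elt_ball.
  replace (minus f (Elt c Hc_summable))
    with (elt_plus X (minus f x) (minus x (Elt c Hc_summable)))
    by (apply elt_eq; intros k; simpl; ring).
  assert (Ht := elt_norm_triangle X (minus f x) (minus x (Elt c Hc_summable))).
  change (elt_norm X (minus x (Elt c Hc_summable)) <= eps / 2) in Hn; lra.
Qed.

Definition elt_lim (F : (elt X -> Prop) -> Prop) : elt X :=
  epsilon (inhabits (elt_zero X)) (fun c => forall eps : posreal, F (elt_ball X c eps)).

Lemma elt_lim_ball (F : (elt_UniformSpace X -> Prop) -> Prop) :
  ProperFilter F -> cauchy F -> forall eps : posreal, F (ball (elt_lim F) eps).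
Proof.
  intros PF CF; exact (epsilon_spec (inhabits (elt_zero X)) _ (elt_cauchy_limit F PF CF)).
Qed.

(** [elt_lim] is chosen by [epsilon] from a predicate in the filter, so equivalent filters are first
    identified by extensionality. *)
Lemma elt_lim_close (F G : (elt_UniformSpace X -> Prop) -> Prop) :
  filter_le F G -> filter_le G F -> close (elt_lim F) (elt_lim G).
Proof.
  intros H1 H2.
  replace G with F; [intros eps; apply ball_center|].
  apply functional_extensionality; intros P; apply propositional_extensionality.
  split; [apply H2 | apply H1].
Qed.

Definition elt_CompleteSpace_mixin : CompleteSpace.mixin_of (elt_UniformSpace X) :=
  CompleteSpace.Mixin (elt_UniformSpace X) elt_lim elt_lim_ball elt_lim_close.

Definition elt_CompleteNormedModule : CompleteNormedModule R_AbsRing :=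
  CompleteNormedModule.Pack R_AbsRing (elt X)
    (CompleteNormedModule.Class R_AbsRing (elt X)
       (NormedModule.class R_AbsRing (elt_NormedModule X)) elt_CompleteSpace_mixin)
    (elt X).

End Completeness.

(** * The collision operator as a field on [X] *)

Section CollisionOperator.

Context (K : Z -> Z -> R) (CK : R).
Hypothesis CK_pos : 0 < CK.
Hypothesis K_nonneg : forall k l, 0 <= K k l.
Hypothesis K_le : forall k l, K k l <= CK.
Context (X : lspace).

Lemma ex_sumZ_Rabs_coef (f : elt X) : ex_sumZ (fun k => Rabs (f k)).
Proof.
  apply ex_sumZ_le with (2 := coef_summable f); intros k.
  assert (Hw := weight_ge_1 X k); assert (Ha := Rabs_pos (f k)); nra.
Qed.

Lemma sumZ_Rabs_coef_le (f : elt X) : sumZ (fun k => Rabs (f k)) <= elt_norm X f.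
Proof.
  apply sumZ_le with (2 := coef_summable f); intros k.
  assert (Hw := weight_ge_1 X k); assert (Ha := Rabs_pos (f k)); nra.
Qed.

Lemma kernel_sum_bound (a : Z -> R) (g : elt X) : (forall l, 0 <= a l <= CK) ->
  ex_sumZ (fun l => a l * g l) /\ Rabs (sumZ (fun l => a l * g l)) <= CK * elt_norm X g.
Proof.
  intros Ha.
  assert (Hle : forall l, 0 <= Rabs (a l * g l) <= CK * Rabs (g l)).
  { intros l; split; [apply Rabs_pos|]; rewrite Rabs_mult, (Rabs_pos_eq (a l)) by apply Ha.
    apply Rmult_le_compat_r; [apply Rabs_pos | apply Ha]. }
  assert (Hs := ex_sumZ_scal CK _ (ex_sumZ_Rabs_coef g)).
  assert (He : ex_sumZ (fun l => Rabs (a l * g l))) by exact (ex_sumZ_le _ _ Hle Hs).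
  split; [apply ex_sumZ_Rabs, He|].
  eapply Rle_trans; [apply Rabs_sumZ_le, He|].
  eapply Rle_trans; [apply sumZ_le with (1 := Hle) (2 := Hs)|].
  rewrite sumZ_scal; apply Rmult_le_compat_l; [lra | apply sumZ_Rabs_coef_le].
Qed.

(** The rates at which collisions with [g] move mass from [k] up to [k + 1] and, for [loss_rate],
    down to [k - 1]. *)
Definition gain_rate (g : elt X) (k : Z) : R := sumZ (fun l => K l k * g l).
Definition loss_rate (g : elt X) (k : Z) : R := sumZ (fun l => K k l * g l).

Lemma K_bounds k l : 0 <= K k l <= CK.
Proof. split; [apply K_nonneg | apply K_le]. Qed.

Lemma sumZ_minus u v : ex_sumZ u -> ex_sumZ v ->
  sumZ (fun k => u k - v k) = sumZ u - sumZ v.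
Proof.
  intros Hu Hv.
  replace (sumZ u - sumZ v) with (sumZ u + (-1) * sumZ v) by ring.
  rewrite <- sumZ_scal, <- sumZ_plus by (auto using ex_sumZ_scal).
  apply sumZ_ext; intros k; ring.
Qed.

Lemma ex_sumZ_minus u v : ex_sumZ u -> ex_sumZ v -> ex_sumZ (fun k => u k - v k).
Proof.
  intros Hu Hv; destruct (ex_sumZ_plus _ _ Hu (ex_sumZ_scal (-1) _ Hv)) as [H1 H2].
  split; [apply ex_series_ext with (2 := H1) | apply ex_series_ext with (2 := H2)];
    intros n; apply Rminus_diag_uniq; ring.
Qed.

(** The values of [f] leave the sum over [l], and a shift of [l] absorbs the index [l - 1]. What
    remains is a nearest-neighbour operator in [k] whose rates are linear in [g]. *)
Lemma collision_rates (f g : elt X) k : collision K f g k =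
  f (k - 1)%Z * gain_rate g (k - 1) - f k * loss_rate g k
  - f k * gain_rate g k + f (k + 1)%Z * loss_rate g (k + 1).
Proof.
  assert (EG : forall k, ex_sumZ (fun l => K l k * g l)).
  { intros j; apply kernel_sum_bound; intros l; apply K_bounds. }
  assert (EL : forall k, ex_sumZ (fun l => K k l * g l)).
  { intros j; apply kernel_sum_bound; intros l; apply K_bounds. }
  assert (SL := fun k => ex_sumZ_shift_pred _ (EL k)).
  unfold collision, gain_rate, loss_rate.
  rewrite <- (proj2 (SL k)), <- (proj2 (SL (k + 1)%Z)).
  rewrite <- !sumZ_scal.
  rewrite <- !sumZ_minus, <- sumZ_plus
    by (repeat apply ex_sumZ_minus; apply ex_sumZ_scal; auto; apply SL).
  apply sumZ_ext; intros l; ring.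
Qed.

Lemma gain_rate_bound (g : elt X) k : Rabs (gain_rate g k) <= CK * elt_norm X g.
Proof. apply kernel_sum_bound; intros l; apply K_bounds. Qed.

Lemma loss_rate_bound (g : elt X) k : Rabs (loss_rate g k) <= CK * elt_norm X g.
Proof. apply kernel_sum_bound; intros l; apply K_bounds. Qed.

Lemma gain_rate_minus (f g : elt X) k : gain_rate (minus f g) k = gain_rate f k - gain_rate g k.
Proof.
  unfold gain_rate; rewrite <- sumZ_minus
    by (apply kernel_sum_bound; intros l; apply K_bounds).
  apply sumZ_ext; intros l; change (minus f g l) with (f l - g l); ring.
Qed.

Lemma loss_rate_minus (f g : elt X) k : loss_rate (minus f g) k = loss_rate f k - loss_rate g k.
Proof.
  unfold loss_rate; rewrite <- sumZ_minus
    by (apply kernel_sum_bound; intros l; apply K_bounds).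
  apply sumZ_ext; intros l; change (minus f g l) with (f l - g l); ring.
Qed.

Lemma product_difference_bound (a b r s m e : R) :
  Rabs r <= m -> Rabs (r - s) <= e ->
  Rabs (a * r - b * s) <= m * Rabs (a - b) + e * Rabs b.
Proof.
  intros Hr Hrs.
  replace (a * r - b * s) with ((a - b) * r + b * (r - s)) by ring.
  eapply Rle_trans; [apply Rabs_triang|]; rewrite !Rabs_mult.
  assert (H1 := Rabs_pos (a - b)); assert (H2 := Rabs_pos b); nra.
Qed.

Lemma weight_succ_pred k :
  weight X k <= 2 * weight X (k - 1)%Z /\ weight X k <= 2 * weight X (k + 1)%Z.
Proof.
  destruct X; simpl; [lra|].
  rewrite minus_IZR, plus_IZR; unfold Rabs; repeat destruct Rcase_abs; lra.
Qed.

(** Each product difference splits as [(f - g) r + g (r - s)], and linearity of the rates bounds it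
    by [p]. The four products give [p (k-1) + 2 p k + p (k+1)]; moving the weight to the neighbours
    costs a factor 2, so three copies of [2 * sumZ q] remain, which is the 6. The case [g = 0] shows
    that [Q] maps [X] into itself. *)
Lemma Q_difference (f g : elt X) :
  ex_sumZ (fun k => weight X k * Rabs (Q K f k - Q K g k)) /\
  sumZ (fun k => weight X k * Rabs (Q K f k - Q K g k))
    <= 6 * CK * (elt_norm X f + elt_norm X g) * elt_norm X (minus f g).
Proof.
  set (d := minus f g).
  set (m := CK * elt_norm X f); set (e := CK * elt_norm X d).
  assert (norm_nonneg : forall h : elt X, 0 <= elt_norm X h).
  { intros h; eapply Rle_trans; [|apply (Rabs_coef_le_norm X h 0)]; apply wabs_ge0. }
  assert (Hm : 0 <= m) by (apply Rmult_le_pos; [lra | apply norm_nonneg]).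
  assert (He : 0 <= e) by (apply Rmult_le_pos; [lra | apply norm_nonneg]).
  set (p := fun k => m * Rabs (d k) + e * Rabs (g k)).
  assert (Hp : forall k, 0 <= p k).
  { intros k; unfold p; assert (H1 := Rabs_pos (d k)); assert (H2 := Rabs_pos (g k)); nra. }
  assert (HG : forall k j, Rabs (f j * gain_rate f k - g j * gain_rate g k) <= p j).
  { intros k j; apply product_difference_bound; [apply gain_rate_bound |].
    rewrite <- gain_rate_minus; apply gain_rate_bound. }
  assert (HL : forall k j, Rabs (f j * loss_rate f k - g j * loss_rate g k) <= p j).
  { intros k j; apply product_difference_bound; [apply loss_rate_bound |].
    rewrite <- loss_rate_minus; apply loss_rate_bound. }
  set (q := fun k => weight X k * p k).
  assert (Hq : forall k, 0 <= q k).
  { intros k; unfold q; assert (Hw := weight_ge_1 X k); specialize (Hp k); nra. }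
  assert (Eq' : forall k, q k = m * (weight X k * Rabs (d k)) + e * (weight X k * Rabs (g k))).
  { intros k; unfold q, p; ring. }
  assert (Sq : ex_sumZ q /\ sumZ q = m * elt_norm X d + e * elt_norm X g).
  { assert (E1 := ex_sumZ_scal m _ (coef_summable d)).
    assert (E2 := ex_sumZ_scal e _ (coef_summable g)).
    split.
    - apply ex_sumZ_le with (2 := ex_sumZ_plus _ _ E1 E2); intros k.
      split; [apply Hq | rewrite Eq'; lra].
    - rewrite (sumZ_ext _ _ Eq'), sumZ_plus, !sumZ_scal by assumption; reflexivity. }
  destruct Sq as [Sq Nq].
  destruct (ex_sumZ_shift_pred q Sq) as [Sq1 Nq1].
  destruct (ex_sumZ_shift_succ q Sq) as [Sq2 Nq2].
  assert (Hle : forall k, 0 <= weight X k * Rabs (Q K f k - Q K g k)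
                  <= 2 * (q (k - 1)%Z + q k + q (k + 1)%Z)).
  { intros k; split; [apply (wabs_ge0 X (fun k => Q K f k - Q K g k))|].
    assert (Hb : Rabs (Q K f k - Q K g k) <= p (k - 1)%Z + 2 * p k + p (k + 1)%Z).
    { unfold Q; rewrite !collision_rates.
      assert (H1 := HG (k - 1)%Z (k - 1)%Z); assert (H2 := HL k k).
      assert (H3 := HG k k); assert (H4 := HL (k + 1)%Z (k + 1)%Z).
      apply Rabs_le; apply Rabs_le_between in H1, H2, H3, H4; lra. }
    destruct (weight_succ_pred k) as [W1 W2].
    assert (Hw := weight_ge_1 X k); unfold q.
    assert (P1 := Hp (k - 1)%Z); assert (P2 := Hp (k + 1)%Z).
    apply Rle_trans with (weight X k * (p (k - 1)%Z + 2 * p k + p (k + 1)%Z)).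
    - apply Rmult_le_compat_l; lra.
    - assert (weight X k * p (k - 1)%Z <= 2 * weight X (k - 1)%Z * p (k - 1)%Z)
        by (apply Rmult_le_compat_r; lra).
      assert (weight X k * p (k + 1)%Z <= 2 * weight X (k + 1)%Z * p (k + 1)%Z)
        by (apply Rmult_le_compat_r; lra).
      lra. }
  assert (S3 := ex_sumZ_scal 2 _ (ex_sumZ_plus _ _ (ex_sumZ_plus _ _ Sq1 Sq) Sq2)).
  split; [apply ex_sumZ_le with (1 := Hle) (2 := S3)|].
  eapply Rle_trans; [apply sumZ_le with (1 := Hle) (2 := S3)|].
  rewrite sumZ_scal, (sumZ_plus (fun k => q (k - 1)%Z + q k)), (sumZ_plus (fun k => q (k - 1)%Z)), Nq1, Nq2, Nq
    by (repeat apply ex_sumZ_plus; assumption).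
  unfold m, e; right; ring.
Qed.

Lemma Q_summable (f : elt X) : ex_sumZ (fun k => weight X k * Rabs (Q K f k)).
Proof.
  apply ex_sumZ_le with (2 := proj1 (Q_difference f (elt_zero X))); intros k.
  split; [apply wabs_ge0|]; right; do 2 f_equal.
  unfold Q at 3; rewrite collision_rates; simpl; ring.
Qed.

Definition Q_elt (f : elt X) : elt X := Elt (Q K f) (Q_summable f).

Lemma Q_elt_Lipschitz : forall M, exists L, 0 < L /\
  forall u v : elt_CompleteNormedModule X, norm u <= M -> norm v <= M ->
    norm (minus (Q_elt u : elt_CompleteNormedModule X) (Q_elt v)) <= L * norm (minus u v).
Proof.
  (* Twice the 6 of [Q_difference], as both norms are at most [M]; [Rabs] and [+ 1] keep the
     constant positive for every real [M]. *)
  intros M; exists (12 * CK * Rabs M + 1).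
  assert (HM := Rabs_pos M); assert (HM' := Rle_abs M).
  assert (0 <= CK * Rabs M) by (apply Rmult_le_pos; lra).
  split; [lra|]; intros u v Hu Hv.
  apply Rle_trans with (1 := proj2 (Q_difference u v)).
  apply Rmult_le_compat_r; [exact (norm_ge_0 (minus u v))|].
  change (elt_norm X u <= M) in Hu; change (elt_norm X v <= M) in Hv; nra.
Qed.

End CollisionOperator.

(** * The initial value problem *)

Section C1Solutions.

Context {V : CompleteNormedModule R_AbsRing}.

(** At a limit point of [D] the derivative is unique, which pins down the value chosen by [epsilon]
    in [Derive_on]. *)
Lemma Derive_on_eq D (f : R -> V) t l :
  D t -> limit_point D t -> has_derive D f t l ->
  is_derive_on D f t (Derive_on D f t) /\ Derive_on D f t = l.
Proof.
  intros Dt Hacc Hl.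
  assert (H : is_derive_on D f t (Derive_on D f t)).
  { apply (epsilon_spec (inhabits zero) (is_derive_on D f t)).
    exists l; apply is_derive_on_has_derive; assumption. }
  split; [exact H|].
  apply is_derive_on_has_derive in H; [|exact Dt].
  apply (has_derive_unique D f t); assumption.
Qed.

Context (F : V -> V).
Hypothesis F_Lip : forall M, exists L, 0 < L /\ forall u v : V,
  norm u <= M -> norm v <= M -> norm (minus (F u) (F v)) <= L * norm (minus u v).

Lemma continuous_within_comp D (f : R -> V) t :
  continuous_within D f t -> continuous_within D (fun s => F (f s)) t.
Proof.
  intros H e He; destruct (F_Lip (norm (f t) + 1)) as [L [HL HF]].
  destruct (H (Rmin 1 (e / L))) as [d [Hd Hs]].
  { apply Rmin_glb_lt; [lra | apply Rdiv_lt_0_compat; lra]. }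
  assert (H1 := Rmin_l 1 (e / L)); assert (H2 := Rmin_r 1 (e / L)).
  exists d; split; [exact Hd|]; intros s Ds Hst; specialize (Hs s Ds Hst).
  assert (H3 := norm_le_plus_minus (f s) (f t)).
  eapply Rle_lt_trans; [apply HF; lra|].
  apply Rlt_le_trans with (L * (e / L)); [apply Rmult_lt_compat_l; lra|].
  right; field; lra.
Qed.

(** The derivative is [F] along [f], hence continuous because [f] and [F] are. *)
Lemma C1_on_solution D (f : R -> V) :
  (forall t, D t -> limit_point D t) ->
  (forall t, D t -> has_derive D f t (F (f t))) -> C1_on D f.
Proof.
  intros Hacc Hf.
  assert (HD := fun t Dt => Derive_on_eq D f t _ Dt (Hacc t Dt) (Hf t Dt)).
  split; [intros t Dt; apply (HD t Dt)|].
  intros t Dt; apply (continuous_within_filterlim D (Derive_on D f)).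
  apply continuous_within_local with (D := D) (f := fun s => F (f s)) (r := 1); [lra | | |].
  - intros s Ds _; split; [exact Ds | apply (HD s Ds)].
  - apply (HD t Dt).
  - apply continuous_within_comp, has_derive_continuous_within with (1 := Hf t Dt).
Qed.

Lemma limit_point_Ico0 tau t : Ico0 tau t -> limit_point (Ico0 tau) t.
Proof.
  intros Ht; destruct (Ico0_between tau t Ht) as [T [H1 H2]].
  apply limit_point_subset with (Icc0 T).
  - intros s Hs; apply Ico0_Icc0 with (1 := H2) (2 := Hs).
  - destruct Ht; apply limit_point_Icc0; [lra | split; lra].
Qed.

(* The equation at [t = 0], which [is_solution] does not impose, follows from
   the continuity of both sides. *)
Lemma C1_solution_solves v tau (f : R -> V) :
  Rbar_lt 0 tau -> C1_on (Ico0 tau) f -> f 0 = v ->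
  (forall t, 0 < t -> Rbar_lt t tau -> Derive_on (Ico0 tau) f t = F (f t)) ->
  solves F v tau f.
Proof.
  intros Hpos [Hd Hc] H0 Heq; set (D := Ico0 tau) in *.
  set (f' := Derive_on D f : R -> V) in *.
  assert (Hd' : forall t, D t -> has_derive D f t (f' t)).
  { intros t Dt; apply is_derive_on_has_derive; [exact Dt | apply Hd, Dt]. }
  assert (D0 : D 0) by (split; [lra | exact Hpos]).
  assert (Heq0 : f' 0 = F (f 0)).
  { apply norm_minus_le0, Rnot_lt_le; intros Hp.
    set (p := norm (minus (f' 0) (F (f 0)))) in *.
    assert (C1 := filterlim_continuous_within D f' 0 (Hc 0 D0)).
    assert (C2 := continuous_within_comp D f 0
                    (has_derive_continuous_within _ _ _ _ (Hd' 0 D0))).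
    destruct (C1 (p / 2) ltac:(lra)) as [d1 [Hd1 E1]].
    destruct (C2 (p / 2) ltac:(lra)) as [d2 [Hd2 E2]].
    destruct (limit_point_Ico0 tau 0 D0 (Rmin d1 d2)) as [s [Ds Hs]];
      [apply Rmin_glb_lt; assumption|].
    assert (H1 := Rmin_l d1 d2); assert (H2 := Rmin_r d1 d2).
    specialize (E1 s Ds ltac:(lra)); specialize (E2 s Ds ltac:(lra)).
    assert (Hs0 : 0 < s).
    { destruct Ds as [Ds _]; destruct (Req_dec s 0) as [->|]; [|lra].
      rewrite Rminus_diag, Rabs_R0 in Hs; lra. }
    rewrite (Heq s Hs0 (proj2 Ds)) in E1.
    assert (H3 := norm_minus_triangle (f' 0) (F (f s)) (F (f 0))).
    rewrite (norm_minus_sym (f' 0) (F (f s))) in H3; fold p in H3; lra. }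
  split; [exact Hpos|]; split; [exact H0|]; intros t Dt.
  destruct (Req_dec t 0) as [->|Hne].
  - rewrite <- Heq0; apply Hd', D0.
  - rewrite <- Heq; [apply Hd', Dt | destruct Dt; lra | apply Dt].
Qed.

Lemma sup_norm_le D (f : R -> V) (B : R) :
  (forall t, D t -> norm (f t) <= B) -> Rbar_le (sup_norm D f) B.
Proof.
  intros H; apply Lub_Rbar_correct; intros r [t [Dt ->]]; exact (H t Dt).
Qed.

End C1Solutions.

Section InitialValueProblem.

Context (K : Z -> Z -> R) (CK : R).
Hypothesis CK_pos : 0 < CK.
Hypothesis K_nonneg : forall k l, 0 <= K k l.
Hypothesis K_le : forall k l, K k l <= CK.
Context (X : lspace).

Let V := elt_CompleteNormedModule X.
Let QX : V -> V := Q_elt K CK CK_pos K_nonneg K_le X.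
Let QX_Lip := Q_elt_Lipschitz K CK CK_pos K_nonneg K_le X.

Lemma is_solution_solves (f0 : elt X) tau (f : R -> elt X) :
  is_solution K f0 tau f <-> solves (V := V) QX f0 tau f.
Proof.
  split.
  - intros [Hpos [HC1 [H0 Heq]]].
    apply (C1_solution_solves (V := V) QX QX_Lip); trivial.
    intros t Ht1 Ht2; apply elt_eq; exact (Heq t Ht1 Ht2).
  - intros [Hpos [H0 Hf]]; split; [exact Hpos|]; split; [|split; [exact H0|]].
    + exact (C1_on_solution (V := V) QX QX_Lip _ f (limit_point_Ico0 tau) Hf).
    + intros t Ht1 Ht2 k.
      assert (Dt : Ico0 tau t) by (split; [lra | exact Ht2]).
      assert (H := proj2 (Derive_on_eq (V := V) _ f t _ Dt (limit_point_Ico0 tau t Dt) (Hf t Dt))).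
      change (coef (Derive_on (V := V) (Ico0 tau) f t) k = coef (QX (f t)) k).
      rewrite H; reflexivity.
Qed.

Lemma is_maximal_solution_solves (f0 : elt X) tau (f : R -> elt X) :
  is_maximal_solution K f0 tau f <-> solves_maximally (V := V) QX f0 tau f.
Proof.
  split; intros [Hf Hmax]; apply is_solution_solves in Hf; (split; [exact Hf|]).
  - intros sigma g Hg; apply Rbar_not_lt_le; intros Hlt.
    apply (Rbar_lt_not_le _ _ Hlt), (Hmax sigma g); [apply is_solution_solves, Hg|].
    intros t Ht; apply (solves_agree (V := V) QX QX_Lip f0 sigma tau); [exact Hg | exact Hf | | exact Ht].
    split; [apply Ht | apply Rbar_lt_trans with (1 := proj2 Ht) (2 := Hlt)].
  - intros sigma g Hg _; apply (Hmax sigma g), is_solution_solves, Hg.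
Qed.

Lemma phi_solves_maximally (f0 : elt X) :
  solves_maximally (V := V) QX f0 (tplus K f0) (phi K f0).
Proof.
  apply is_maximal_solution_solves.
  apply (epsilon_spec (inhabits (p_infty, fun _ => f0))
           (fun p => is_maximal_solution K f0 (fst p) (snd p))).
  destruct (exists_solves_maximally (V := V) QX QX_Lip f0) as [tau [f Hf]].
  exists (tau, f); apply is_maximal_solution_solves, Hf.
Qed.

Lemma maximal_solution_unique (f0 : elt X) tau (g : R -> elt X) :
  is_maximal_solution K f0 tau g ->
  tau = tplus K f0 /\ forall t, Ico0 tau t -> g t = phi K f0 t.
Proof.
  intros Hg; apply is_maximal_solution_solves in Hg.
  destruct Hg as [Hg Hgmax]; destruct (phi_solves_maximally f0) as [Hf Hfmax].
  assert (E : tau = tplus K f0).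
  { apply Rbar_le_antisym; [exact (Hfmax _ _ Hg) | exact (Hgmax _ _ Hf)]. }
  split; [exact E|]; intros t Ht.
  apply (solves_agree (V := V) QX QX_Lip f0 tau (tplus K f0)); trivial.
  rewrite <- E; exact Ht.
Qed.

Lemma phi_has_derive (g0 : elt X) T t : 0 < T -> Rbar_lt T (tplus K g0) -> Icc0 T t ->
  has_derive (V := V) (Icc0 T) (phi K g0) t (QX (phi K g0 t)).
Proof.
  intros HT HTt Ht; apply (solves_Icc0 (V := V) QX g0 (tplus K g0)).
  - apply phi_solves_maximally.
  - split; [lra | exact HTt].
  - exact Ht.
Qed.

Lemma phi_Lipschitz (f0 : elt X) T : 0 < T -> Rbar_lt T (tplus K f0) ->
  exists delta : R, 0 < delta /\
    (forall g0 : elt X, norm (minus g0 f0) <= delta -> Rbar_lt T (tplus K g0)) /\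
    exists L : R, forall g0 h0 : elt X,
      norm (minus g0 f0) <= delta -> norm (minus h0 f0) <= delta ->
      Rbar_le (C1_norm (Icc0 T) (fun t => minus (phi K g0 t) (phi K h0 t)))
              (L * norm (minus g0 h0)).
Proof.
  intros HT HTt.
  destruct (maximal_solution_dependence (V := V) QX QX_Lip f0 (tplus K f0) (phi K f0) T)
    as [delta [L [Hdelta [HL [Htime HLip]]]]]; [apply phi_solves_maximally | exact HT | exact HTt |].
  assert (Htime' : forall g0 : elt X, norm (minus g0 f0) <= delta -> Rbar_lt T (tplus K g0)).
  { intros g0 Hg0; exact (Htime g0 Hg0 _ _ (phi_solves_maximally g0)). }
  exists delta; split; [exact Hdelta|]; split; [exact Htime'|].
  (* The [C^1] norm adds two sup norms, of the difference and of its derivative, each at most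
     [L * norm (minus g0 h0)]. *)
  exists (2 * L); intros g0 h0 Hg0 Hh0.
  assert (HB := HLip g0 h0 _ _ _ _ Hg0 Hh0 (phi_solves_maximally g0) (phi_solves_maximally h0)).
  assert (Htwice : Finite (2 * L * norm (minus g0 h0))
    = Rbar_plus (L * norm (minus g0 h0)) (L * norm (minus g0 h0))).
  { simpl; f_equal; ring. }
  rewrite Htwice; apply Rbar_plus_le_compat.
  - apply (sup_norm_le (V := V)); intros t Ht; exact (proj1 (HB t Ht)).
  - apply (sup_norm_le (V := V)); intros t Ht.
    assert (Hd := has_derive_minus (V := V) _ _ _ t _ _
             (phi_has_derive g0 T t HT (Htime' g0 Hg0) Ht)
             (phi_has_derive h0 T t HT (Htime' h0 Hh0) Ht)).
    assert (HD := proj2 (Derive_on_eq (V := V) _ _ t _ Ht (limit_point_Icc0 T t HT Ht) Hd)).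
    apply Rle_trans with (2 := proj2 (HB t Ht)); right; exact (f_equal norm HD).
Qed.

End InitialValueProblem.

Theorem theorem2p2 :
  forall (K : Z -> Z -> R) (CK : R),
    0 < CK ->
    (forall k l, 0 <= K k l) ->
    (forall k l, K k l <= CK) ->
  forall (X : lspace) (f0 : elt X),
    (* (i) *)
    (is_maximal_solution K f0 (tplus K f0) (phi K f0) /\
     forall (tau : Rbar) (g : R -> elt X),
       is_maximal_solution K f0 tau g ->
       tau = tplus K f0 /\ forall t, Ico0 tau t -> g t = phi K f0 t)
    /\
    (* (ii) *)
    (forall tau : R, tplus K f0 = Finite tau ->
       filterlim (fun t => norm (phi K f0 t)) (at_left tau) (Rbar_locally p_infty))
    /\
    (* (iii) *)
    (forall T : R, 0 < T -> Rbar_lt T (tplus K f0) ->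
       exists delta : R, 0 < delta /\
         (forall g0 : elt X, norm (minus g0 f0) <= delta -> Rbar_lt T (tplus K g0)) /\
         (forall g0 : elt X, norm (minus g0 f0) <= delta ->
            C1_on (Icc0 T) (phi K g0)) /\
         exists L : R, forall g0 h0 : elt X,
           norm (minus g0 f0) <= delta -> norm (minus h0 f0) <= delta ->
           Rbar_le (C1_norm (Icc0 T) (fun t => minus (phi K g0 t) (phi K h0 t)))
                   (L * norm (minus g0 h0))).
Proof.
  intros K CK CK_pos K_nonneg K_le X f0.
  assert (Hphi := phi_solves_maximally K CK CK_pos K_nonneg K_le X).
  assert (Lip := Q_elt_Lipschitz K CK CK_pos K_nonneg K_le X).
  split; [split|split].
  - exact (proj2 (is_maximal_solution_solves K CK CK_pos K_nonneg K_le X f0 _ _) (Hphi f0)).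
  - exact (maximal_solution_unique K CK CK_pos K_nonneg K_le X f0).
  - intros tau Htau; specialize (Hphi f0); rewrite Htau in Hphi.
    exact (maximal_solution_blowup (V := elt_CompleteNormedModule X) _ Lip f0 tau _ Hphi).
  - intros T HT HTt.
    destruct (phi_Lipschitz K CK CK_pos K_nonneg K_le X f0 T HT HTt)
      as [delta [Hdelta [Htime HL]]].
    exists delta; split; [exact Hdelta|]; split; [exact Htime|]; split; [|exact HL].
    intros g0 Hg0.
    apply (C1_on_solution (V := elt_CompleteNormedModule X) _ Lip).
    + intros t Ht; apply limit_point_Icc0; assumption.
    + intros t Ht; apply phi_has_derive; auto.
Qed.
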